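(* If $f$ is a pure mixing map of a graph $G$, then (1) $h(f)>\dfrac{1}{\Lambda(G)}\cdot\log 3$; (2) there exists an integer $0<m<\Lambda(G)$ such that $f^m$ has infinitely many fixed points.
   Context: A (topological) graph is a compact connected metric space homeomorphic to the geometric carrier of a one-dimensional simplicial complex. A subgraph of $G$ is a subset of $G$ that is itself a graph, equivalently a nondegenerate subcontinuum of $G$. All maps are continuous. A map $f\colon G\to G$ is mixing if for any nonempty open $U,V\subset G$ there is $N>0$ with $f^n(U)\cap V\neq\emptyset$ for all $n\ge N$; it is exact if for every nonempty open $U\subset G$ there is $n\ge 0$ with $f^n(U)=G$; it is pure mixing if it is mixing but not exact. $h(f)\in[0,+\infty]$ denotes topological entropy. The disconnecting number $D^s(G)$ of a graph $G$ is the least $n>0$ such that for every subset $D\subset G$ of cardinality $n$ the set $G\setminus D$ is not connected. $\Lambda(G)$ denotes the maximal disconnecting number among all subgraphs of $G$. *)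

(* Defs.v *)
From HB Require Import structures.
From mathcomp Require Import all_boot all_order all_algebra.
From mathcomp Require Import all_classical all_reals all_analysis.
Import Order.TTheory GRing.Theory Num.Theory.
Import numFieldNormedType.Exports.

Set Implicit Arguments.
Unset Strict Implicit.
Unset Printing Implicit Defensive.

Local Open Scope classical_set_scope.
Local Open Scope card_scope.
Local Open Scope ring_scope.

Definition homeomorphic (T U : topologicalType) (A : set T) (B : set U) : Prop :=
  exists (f : T -> U) (g : U -> T),
    [/\ {within A, continuous f}, {within B, continuous g},
        (forall x, A x -> B (f x) /\ g (f x) = x) &
        (forall y, B y -> A (g y) /\ f (g y) = y)].

(* Only finite complexes are considered: a simplicial complex with compact
   carrier is finite. *)
Definition simplicial_complex (n : nat) (K : {set {set 'I_n}}) : Prop :=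
  finset.set0 \notin K /\
  forall s t : {set 'I_n},
    s \in K -> t != finset.set0 -> t \subset s -> t \in K.

Definition one_dimensional (n : nat) (K : {set {set 'I_n}}) : Prop :=
  (forall s : {set 'I_n}, s \in K -> (#|s| <= 2)%N) /\
  exists s : {set 'I_n}, s \in K /\ #|s| = 2%N.

(* The convex hull of the basis vectors of R^n with index in s. *)
Definition geometric_simplex (R : realType) (n : nat) (s : {set 'I_n}) :
    set 'rV[R]_n :=
  [set x : 'rV[R]_n | [/\ forall i, 0 <= x ord0 i,
    \sum_(i < n) x ord0 i = 1 &
    forall i, i \notin s -> x ord0 i = 0]].

Definition carrier (R : realType) (n : nat) (K : {set {set 'I_n}}) :
    set 'rV[R]_n :=
  \bigcup_(s in [set s | s \in K]) @geometric_simplex R n s.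

(* The graph G itself is the case A = setT; the subgraphs of G are the sets A
   with is_graph A. *)
Definition is_graph (R : realType) (T : metricType R) (A : set T) : Prop :=
  [/\ compact A, connected A &
      exists (n : nat) (K : {set {set 'I_n}}),
        [/\ simplicial_complex K, one_dimensional K &
            homeomorphic A (@carrier R n K)]].

Definition mixing (T : topologicalType) (f : T -> T) : Prop :=
  forall U V : set T, open U -> open V -> U !=set0 -> V !=set0 ->
    exists N : nat, (0 < N)%N /\
      forall n : nat, (N <= n)%N -> (iter n f @` U) `&` V !=set0.

Definition exact_map (T : topologicalType) (f : T -> T) : Prop :=
  forall U : set T, open U -> U !=set0 -> exists n : nat, iter n f @` U = setT.

Definition pure_mixing (T : topologicalType) (f : T -> T) : Prop :=
  mixing f /\ ~ exact_map f.

(* Topological entropy, in Bowen's form. *)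
Definition dyn_separated (R : realType) (T : metricType R) (f : T -> T)
    (n : nat) (eps : R) (S : set T) : Prop :=
  forall x y, S x -> S y -> x <> y ->
    exists2 k : nat, (k < n)%N & eps < mdist (iter k f x) (iter k f y).

Definition max_separated (R : realType) (T : metricType R) (f : T -> T)
    (n : nat) (eps : R) : \bar R :=
  ereal_sup [set k%:R%:E | k in
    [set k : nat | exists2 S : set T, S #= `I_k & dyn_separated f n eps S]].

(* The term n = 0 is irrelevant for the limit superior. *)
Definition entropy_at_scale (R : realType) (T : metricType R) (f : T -> T)
    (eps : R) : \bar R :=
  limn_esup (fun n : nat => (n%:R^-1)%:E * lne (max_separated f n eps))%E.

Definition topological_entropy (R : realType) (T : metricType R) (f : T -> T) :
    \bar R :=
  lim (entropy_at_scale f eps @[eps --> 0^'+]).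

Definition disconnecting (T : topologicalType) (A : set T) (n : nat) : Prop :=
  forall D : set T, D `<=` A -> D #= `I_n -> ~ connected (A `\` D).

(* Value 0 if there is no least such n. *)
Definition disconnecting_number (T : topologicalType) (A : set T) : nat :=
  xget 0%N [set n | [/\ (0 < n)%N, disconnecting A n &
    forall m, (0 < m)%N -> disconnecting A m -> (n <= m)%N]].

(* Value 0 if the disconnecting numbers of subgraphs have no maximum. *)
Definition Lambda (R : realType) (T : metricType R) : nat :=
  xget 0%N [set n |
    (exists2 H : set T, is_graph H & disconnecting_number H = n) /\
    (forall H : set T, is_graph H -> (disconnecting_number H <= n)%N)].

(* Main.v *)
(** Some arc J satisfies J <= f^n(J) for all large n while no f^n(J) is the
whole graph. As the sets f^n(J) are connected and eventually meet every open
set, they exhaust the graph except near finitely many one-sided ends, so for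
large n the set f^n(J) is the graph with short half-open arcs cut off at the
w >= 1 inaccessible ends. It is a subgraph that stays connected when the w cut
points are removed, hence w < Lambda(G). Near the inaccessible ends f acts as a
permutation, for otherwise some f^n(J) would reach an inaccessible end; thus
an iterate f^m with m <= w maps some end to itself. In the coordinate t of
that end f^m is a map r fixing 0, and mixing forbids r((0,t]) <= (0,t] as well
as r([t,d)) <= [t,oo). Hence r crosses the diagonal arbitrarily close to 0,
which gives infinitely many fixed points of f^m, and some interval has three
disjoint subintervals each mapped over it, so that h(f) >= log 3 / m. *)

Require Import Defs.
From HB Require Import structures.
From mathcomp Require Import all_boot all_order all_algebra.
From mathcomp Require Import all_classical all_reals all_analysis.
From mathcomp Require Import ring lra zify.
Import Order.TTheory GRing.Theory Num.Theory.
Import numFieldNormedType.Exports.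

Set Implicit Arguments.
Unset Strict Implicit.
Unset Printing Implicit Defensive.

Local Open Scope classical_set_scope.
Local Open Scope ring_scope.

(** * One-sided germs of maps of the line *)

(** All covering statements rest on one principle: a connected set that misses two points of an edge
    but contains a point between them is confined to the part between them. Large images of an arc
    meet every open set, so they cannot be confined, and of two disjoint subarcs of an edge at least
    one is covered. This yields J <= f^k(J) for a single k; a pigeonhole on the residues modulo k
    extends it to all large n. J is chosen inside an open set that refutes exactness, so no image of
    it is the whole graph. The action on ends is read off from preimages: a point close to an
    inaccessible end avoids f^(n+1)(J), so its preimages lie close to inaccessible ends, and the
    choice of a predecessor is an injection of a finite set. The same control of preimages excludes
    r([t,d)) <= [t,oo), which would make (0,t) backward invariant. The number 3 counts the laps
    between four points at which r lies alternately below and above the diagonal. Two facts hide in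
    the statement: the images must be recognized as carriers of complexes, and the maximum defining
    Lambda(G) must exist, which takes a bound on disconnecting numbers uniform in the subgraph. *)

Lemma in_itvcc (R : realType) (x y c : R) : c \in `[x, y] -> x <= c <= y.
Proof. by rewrite in_itv. Qed.

(** A chain of positive points going down from [a], in which [g] carries each new point beyond its
    predecessor. *)
Inductive descent (R : realType) (g : R -> R) (a : R) : R -> Prop :=
| descent_refl : descent g a a
| descent_step x y : descent g a x -> 0 < y < x -> x < g y -> descent g a y.

Section OneSidedGerm.
Variables (R : realType) (g : R -> R) (s d D : R).
Hypotheses (s_gt0 : 0 < s) (sd : s < d) (dD : d < D).
Hypothesis g_cont : forall t : R, 0 < t < D -> {for t, continuous g}.
Hypothesis g_gt0 : forall t : R, 0 < t < D -> 0 < g t.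
Hypothesis g_up : forall t : R, 0 < t < s ->
  exists x : R, 0 < x <= t /\ t < g x.
Hypothesis g_down : forall t : R, 0 < t < s ->
  exists y : R, t <= y < d /\ g y < t.

Local Ltac glra := have := s_gt0; have := sd; have := dD; move=> ? ? ?; lra.

Let g_within (x y : R) : 0 < x -> y < D -> {within `[x, y], continuous g}.
Proof.
move=> x0 y1; apply: continuous_subspace_itv => t.
by rewrite in_itv/= => ?; apply: g_cont; glra.
Qed.

Let g_min (x : R) : 0 < x <= d ->
  exists mu : R, 0 < mu /\ forall u, x <= u <= d -> mu <= g u.
Proof.
case/andP=> x0 xe; have [c + cmin] := EVT_min xe (g_within x0 dD).
move/in_itvcc=> cE; exists (g c); split; first by apply: g_gt0; glra.
by move=> u ue; apply: cmin; rewrite in_itv.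
Qed.

Let g_up_strict (t : R) : 0 < t < s -> exists x : R, 0 < x < t /\ t < g x.
Proof.
move=> ts; have [x [xt tx]] := g_up ts; have t0 : 0 < t by glra.
have [xlt|] := ltrP x t; first by exists x; split => //; glra.
move=> tle; have E : x = t by glra.
move: tx; rewrite E => tgt.
have ct : g u @[u --> t^'-] --> g t by apply: cvg_at_left_filter; apply: g_cont;
  glra.
near t^'- => u; exists u; split.
  apply/andP; split; near: u; [exact: nbhs_left_gt|exact: nbhs_left_lt].
by near: u; exact: (cvgr_gt _ ct).
Unshelve. all: by end_near. Qed.

Lemma germ_fixed_points (eta : R) : 0 < eta ->
  exists p : R, 0 < p < eta /\ g p = p.
Proof.
move=> eta0; have m0 : 0 < Num.min eta s / 2 by rewrite divr_gt0// lt_min eta0.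
have [ms me] : Num.min eta s <= s /\ Num.min eta s <= eta.
  by split; rewrite ge_min lexx ?orbT.
have [|x [xt tx]] := @g_up_strict (Num.min eta s / 2); first glra.
have [|mu [mu0 muE]] := @g_min x; first glra.
have n0 : 0 < Num.min mu x / 2 by rewrite divr_gt0// lt_min mu0; glra.
have [nm nx] : Num.min mu x <= mu /\ Num.min mu x <= x.
  by split; rewrite ge_min lexx ?orbT.
(* On [[x, d]] the values of [g] are at least [mu], so a point sent below [mu] lies to the left of
   [x]; at this point [g] is below the diagonal. *)
have [|y [yt ty]] := @g_down (Num.min mu x / 2); first glra.
have yx : y < x.
  by rewrite ltNge; apply/negP => xy; have := muE y; rewrite xy /=; glra.
have [||c + cE] := @IVT _ (fun u => g u - u) y x 0 (ltW yx).
- apply: continuous_subspace_itv => u /in_itvcc uE.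
  apply: continuousB; first by apply: g_cont; glra.
  exact: cvg_id.
- by rewrite ge_min le_max; apply/andP; split; apply/orP; [left|right]; glra.
by move/in_itvcc=> cE'; exists c; split; glra.
Qed.

Let descent_range (a x : R) : 0 < a < s -> a < g a -> descent g a x ->
  [/\ 0 < x <= a & x < g x].
Proof.
move=> a0 ga; elim=> [|y z _ [ya gy] zy yz]; first by split => //; glra.
by split; glra.
Qed.

Let descent_inf (a : R) : 0 < a < s -> a < g a -> forall c : R, 0 < c ->
  exists x, descent g a x /\ x < c.
Proof.
move=> a0 ga c c0; apply: contrapT => noc.
pose S := [set x | descent g a x].
have Slb : lbound S c.
  by move=> x Sx; rewrite leNgt; apply/negP => xc; apply: noc; exists x.
have S0 : S !=set0 by exists a; exact: descent_refl.
have hS : has_inf S by split => //; exists c.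
have cL : c <= inf S by exact: lb_le_inf.
have La : inf S <= a by apply: ge_inf; [exists c|exact: descent_refl].
have [|x [xL Lx]] := @g_up_strict (inf S); first glra.
have [z Sz zlt] : exists2 z, S z & z < g x by apply: inf_lt.
have Lz : inf S <= z by apply: ge_inf => //; exists c.
have : S x by apply: (descent_step Sz) => //; glra.
move=> Sx; have : inf S <= x by apply: ge_inf => //; exists c.
by glra.
Qed.

(** Chain points lie strictly above the diagonal, so a point [c] below the diagonal is none of them
    and falls strictly between two consecutive ones. *)
Let descent_cross (a x c : R) : 0 < a < s -> a < g a -> descent g a x ->
  x < c -> c < a -> g c < c -> exists x' x'',
  [/\ x <= x', x' < c, c < x'', x'' <= a & x'' < g x' /\ x'' < g x''].
Proof.
move=> a0 ga Dx; elim: Dx c => [|y z Dy IH zy yz] c xc ca gc; first by glra.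
have [cy|yc] := ltrP c y.
  have [ya gy] := descent_range a0 ga Dy.
  by exists z, y; split => //; glra.
have [E|/eqP yNc] := eqVneq y c.
  by move: gc; rewrite -E; have [ya gy] := descent_range a0 ga Dy; glra.
have yltc : y < c by rewrite lt_neqAle yc andbT; apply/eqP.
have [x' [x'' [h1 h2 h3 h4 h5]]] := IH c yltc ca gc.
by exists x', x''; split => //; glra.
Qed.

(** [S] collects the points left of [x] and below the diagonal. The point [y'] that [g_down] gives
    at [sup S] lies to the right of [x]: otherwise it would belong to [S], hence equal [sup S], and
    continuity would put points of [S] beyond it. *)
Let g_down_sup (x : R) : 0 < x < s -> x < g x ->
  exists y y', [/\ 0 < y, y < x, x < y', y' < d & g y' < y /\ g y < y].
Proof.
move=> xs gx; pose S := [set y | 0 < y < x /\ g y < y].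
have [mu [mu0 muE]] : exists mu : R, 0 < mu /\ forall u, x <= u <= d ->
  mu <= g u.
  by apply: g_min; glra.
have n0 : 0 < Num.min mu x / 2 by rewrite divr_gt0// lt_min mu0; glra.
have [nm nx] : Num.min mu x <= mu /\ Num.min mu x <= x.
  by split; rewrite ge_min lexx ?orbT.
have [|y [yt ty]] := @g_down (Num.min mu x / 2); first glra.
have yx : y < x.
  by rewrite ltNge; apply/negP => xy; have := muE y; rewrite xy /=; glra.
have Sy : S y by split; glra.
have ubS : ubound S x by move=> z [zx _]; glra.
have hS : has_sup S by split; [exists y|exists x].
have yL : y <= sup S by apply: ub_le_sup => //; exists x.
have Lx : sup S <= x by apply: ge_sup => //; exists y.
have [|y' [y'L gy']] := @g_down (sup S); first glra.
have [z Sz zlt] : exists2 z, S z & g y' < z by apply: sup_gt => //; exists y.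
have zL : z <= sup S by apply: ub_le_sup => //; exists x.
case: Sz => zx gz.
have [xy'|] := ltrP x y'; first by exists z, y'; split => //; glra.
move=> y'x; have y'Nx : y' != x by apply/eqP => E; move: gx; rewrite -E; glra.
have y'ltx : y' < x by rewrite lt_neqAle y'Nx.
have y'S : y' <= sup S by apply: ub_le_sup; [exists x|split; glra].
have E : y' = sup S by glra.
have ct : g u @[u --> y'^'+] --> g y'.
  by apply: cvg_at_right_filter; apply: g_cont; glra.
exfalso; near y'^'+ => u.
have uy' : y' < u by near: u; exact: nbhs_right_gt.
have ux : u < x by near: u; exact: nbhs_right_lt.
have gu : g u < y' by near: u; apply: (cvgr_lt _ ct); glra.
have : u <= sup S by apply: ub_le_sup; [exists x|split; glra].
by glra.
Unshelve. all: by end_near. Qed.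

(* From a point above the diagonal one descends along x' < x < g x' to a point
   below the values of g away from 0; the level y' of the down-crossing
   y < x < y' found there must be jumped over by one of the descending steps. *)
Lemma germ_zigzag : exists b x y a, [/\ 0 < b, b < x, x < y, y < a & a < d] /\
  [/\ g b < b, a < g x, g y < b & a < g a].
Proof.
have [|a [as' sa]] := @g_up_strict (s / 2); first glra.
have a0 : 0 < a < s by glra.
have ga : a < g a by glra.
have [|mu [mu0 muE]] := @g_min a; first glra.
have [x [Dx xmu]] := descent_inf a0 ga mu0.
have [xa gx] := descent_range a0 ga Dx.
have [|y [y' [y0 yx xy' y'e [gy' gy]]]] := @g_down_sup x _ gx; first glra.
have y'a : y' < a.
  by rewrite ltNge; apply/negP => ay'; have := muE y'; rewrite ay' /=; glra.
have [|x' [x'' [h1 h2 h3 h4 [h5 h6]]]] := descent_cross a0 ga Dx xy' y'a;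
  first glra.
by exists y, x', y', x''; split; split => //; glra.
Qed.

(* The strict inequalities of [germ_zigzag] leave room to separate the three
   laps, so that the intervals below are pairwise disjoint. *)
Lemma germ_horseshoe : exists b a (l r : 'I_3 -> R),
  [/\ 0 < b < a, a < d,
    (forall c, [/\ b <= l c, l c <= r c & r c <= a]),
    (forall c d : 'I_3, (c < d)%N -> r c < l d) &
    (forall c v, b <= v <= a -> exists2 u, l c <= u <= r c & g u = v)].
Proof.
have [b [x [y [a [[b0 bx xy ya ae] [gb gx gy ga]]]]]] := germ_zigzag.
have [cx cy] : {for x, continuous g} /\ {for y, continuous g}.
  by split; apply: g_cont; glra.
have [xm [xm1 xm2]] : exists xm : R, b < xm < x /\ a < g xm.
  have ct : g u @[u --> x^'-] --> g x by exact: cvg_at_left_filter.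
  near x^'- => u; exists u; split; last by near: u; exact: (cvgr_gt _ ct).
  by apply/andP; split; near: u; [exact: nbhs_left_gt|exact: nbhs_left_lt].
have [ym [ym1 ym2]] : exists ym : R, x < ym < y /\ g ym < b.
  have ct : g u @[u --> y^'-] --> g y by exact: cvg_at_left_filter.
  near y^'- => u; exists u; split; last by near: u; exact: (cvgr_lt _ ct).
  by apply/andP; split; near: u; [exact: nbhs_left_gt|exact: nbhs_left_lt].
pose l (c : 'I_3) := if val c is 0%N then b else if val c is 1%N then x else y.
pose r (c : 'I_3) := if val c is 0%N then xm else if val c is 1%N then ym else
  a.
exists b, a, l, r; split => //.
- by glra.
- by move=> [[|[|[|//]]]] /= ?; rewrite /l /r /=; split; glra.
- by move=> [[|[|[|//]]]] /= ? [[|[|[|//]]]] //= ?; rewrite /l /r /= => _; glra.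
move=> c v vE.
have [|||u + uE] := @IVT _ g (l c) (r c) v.
- by case: c => [[|[|[|//]]]] /= ?; rewrite /l /r /=; glra.
- by case: c => [[|[|[|//]]]] /= ?; rewrite /l /r /=; apply: g_within; glra.
- case: c => [[|[|[|//]]]] /= ?; rewrite /l /r /= ge_min le_max;
  by apply/andP; split; apply/orP; solve [left; glra | right; glra].
by move/in_itvcc; exists u.
Unshelve. all: by end_near. Qed.

End OneSidedGerm.

(** * Horseshoes and entropy *)

Section Entropy.
Variables (R : realType) (T : metricType R) (f : T -> T).

Lemma max_separated_anti n (eps eps' : R) : eps <= eps' ->
  (max_separated f n eps' <= max_separated f n eps)%E.
Proof.
move=> le; apply: ereal_sup_le => _ [k [S Sk Ssep] <-].
exists k => //; exists S => // x y Sx Sy xy.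
by have [i ni lt] := Ssep x y Sx Sy xy; exists i => //; apply: le_lt_trans lt.
Qed.

Lemma max_separated_ge0 n (eps : R) : (0 <= max_separated f n eps)%E.
Proof.
apply: ereal_sup_ubound; exists 0%N => //; exists set0 => //.
by rewrite II0.
Qed.

Lemma entropy_at_scale_anti (eps eps' : R) : eps <= eps' ->
  (entropy_at_scale f eps' <= entropy_at_scale f eps)%E.
Proof.
move=> le; rewrite /entropy_at_scale /limn_esup !limf_esupE.
apply: le_ereal_inf_tmp => _ [V VF <-]; apply: ge_ereal_inf.
exists (ereal_sup [set ((n%:R^-1)%:E * lne (max_separated f n eps'))%E | n in
  V]); first by exists V.
apply: ge_ereal_sup => _ [n Vn <-].
apply: le_trans (ereal_sup_ubound (ex_intro2 _ _ n Vn erefl)).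
apply: lee_wpmul2l; first by rewrite lee_fin.
by rewrite lee_lne ?in_itv/= ?leey ?max_separated_ge0// max_separated_anti.
Qed.

(** The entropy at a scale grows as the scale shrinks, so the one-sided limit at 0 is a supremum. *)
Lemma entropy_at_scale_le (eps : R) : 0 < eps ->
  (entropy_at_scale f eps <= topological_entropy f)%E.
Proof.
move=> eps0; rewrite /topological_entropy.
have := @nonincreasing_at_right_cvge R (entropy_at_scale f) 0 +oo%O isT.
move=> /(_ _)/cvg_lim -> //; last first.
  by move=> x y _ _; exact: entropy_at_scale_anti.
by apply: ereal_sup_ubound; exists eps => //=; rewrite in_itv/= eps0.
Qed.

(** * Itineraries in a horseshoe *)

Section Horseshoe.
Variables (p m : nat) (eps : R) (K : 'I_p -> set T) (c0 : 'I_p).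
Hypotheses (m_gt0 : (0 < m)%N) (eps_gt0 : 0 < eps).
Hypothesis K0 : K c0 !=set0.
Hypothesis K_cover : forall c d x, K d x -> exists2 y, K c y & iter m f y = x.
Hypothesis K_sep : forall c d x y, c != d -> K c x -> K d y -> eps < mdist x y.

(** Finite itineraries are built backwards: a letter is prepended by pulling the point back through
    [K_cover]. The clause that the point lies in some [K c] carries the induction. *)
Lemma itinerary_exists (s : seq 'I_p) : exists x, (exists c, K c x) /\
  forall i, (i < size s)%N -> K (nth c0 s i) (iter (i * m) f x).
Proof.
elim: s => [|c s [x [[d Kx] Hx]]]; first by have [x Kx] := K0; exists x;
  split => //; exists c0.
have [y Ky yx] := K_cover c Kx; exists y; split; first by exists c.
case=> [|i] //= lti; rewrite mulSn addnC iterD yx; exact: Hx.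
Qed.

Let pt n (t : n.-tuple 'I_p) : T := projT1 (cid (itinerary_exists t)).

Let ptP n (t : n.-tuple 'I_p) i : (i < n)%N ->
  K (nth c0 t i) (iter (i * m) f (pt t)).
Proof.
rewrite /pt; case: cid => x [_ H] /= lti; apply: H; by rewrite size_tuple.
Qed.

Let pt_sep n (t u : n.-tuple 'I_p) : t != u ->
  exists2 i, (i < n)%N & eps < mdist (iter (i * m) f (pt t))
    (iter (i * m) f (pt u)).
Proof.
move=> tu; apply: contrapT => H; move/eqP: tu; apply.
apply/val_inj/(@eq_from_nth _ c0); rewrite ?size_tuple// => i lti.
apply/eqP/negP => /negP ne; apply: H; exists i => //.
by apply: (K_sep ne); apply: ptP.
Qed.

Lemma horseshoe_separated n : exists2 S : set T, (S #= `I_(p ^ n))%card &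
  dyn_separated f (n * m) eps S.
Proof.
pose q k := pt (nth [tuple of nseq n c0] (enum {: n.-tuple 'I_p}) k).
have sz : size (enum {: n.-tuple 'I_p}) = (p ^ n)%N.
  by rewrite -cardT card_tuple card_ord.
exists [set pt t | t in [set: n.-tuple 'I_p]].
  rewrite (_ : [set pt t | t in _] = q @` `I_(p ^ n)); last first.
    apply/seteqP; split => [_ [t _ <-]|_ [k _ <-]]; last by eexists.
    exists (index t (enum {: n.-tuple 'I_p})).
      by rewrite /= -sz index_mem mem_enum.
    by rewrite /q nth_index// mem_enum.
  apply: inj_card_eq => i j; rewrite !inE /= -sz => lti ltj E.
  apply/eqP; rewrite -(nth_uniq [tuple of nseq n c0] lti ltj) ?enum_uniq//.
  apply/negP => /negP /pt_sep[k _].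
  by rewrite -/(q i) -/(q j) E mdistxx ltNge (ltW eps_gt0).
move=> _ _ [t _ <-] [u _ <-] ne.
have [|i lti lt] := @pt_sep n t u; first by apply/eqP => E; apply: ne;
  rewrite E.
by exists (i * m)%N => //; rewrite ltn_pmul2r.
Qed.

(** An upper limit is an infimum over tails of suprema, and every tail contains a positive time
    [N.+1 * m], at which the itineraries alone contribute exactly [ln p / m]. *)
Lemma horseshoe_entropy : ((m%:R^-1 * ln p%:R)%:E <= topological_entropy f)%E.
Proof.
apply: le_trans (entropy_at_scale_le eps_gt0).
rewrite /entropy_at_scale /limn_esup limf_esupE.
apply: le_ereal_inf_tmp => _ [V [N _ NV] <-].
have p0 : (0 < p)%N by case: (p) (c0) => // -[].
have VN : V (N.+1 * m)%N.
  by apply: NV => /=; apply: leq_trans (leqnSn N) _; exact: leq_pmulr.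
apply: le_trans (ereal_sup_ubound (ex_intro2 _ _ _ VN erefl)).
have le1 : ((p ^ N.+1)%:R%:E <= max_separated f (N.+1 * m) eps)%E.
  apply: ereal_sup_ubound; exists (p ^ N.+1)%N => //.
  by have [S SI Ssep] := horseshoe_separated N.+1; exists S.
apply: (@le_trans _ _ (((N.+1 * m)%:R^-1)%:E * lne (p ^ N.+1)%:R%:E)%E).
  rewrite lne_EFin ?ltr0n ?expn_gt0 ?p0//.
  rewrite natrX lnXn ?ltr0n// -EFinM lee_fin natrM -[ln _ *+ _]mulr_natl.
  rewrite [leRHS](_ : _ = m%:R^-1 * ln p%:R) //; field.
  by rewrite addrC natr1 !pnatr_eq0 -lt0n m_gt0.
apply: lee_wpmul2l; first by rewrite lee_fin invr_ge0.
by rewrite lee_lne ?in_itv/= ?leey ?andbT ?max_separated_ge0 ?lee_fin//.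
Qed.

End Horseshoe.
End Entropy.

(** * Systems of arcs *)

Definition oarc (R : realType) (T : Type) (c : R -> T) (a b : R) : set T :=
  [set x | exists t, a < t < b /\ c t = x].

Definition carc (R : realType) (T : Type) (c : R -> T) (a b : R) : set T :=
  [set x | exists t, a <= t <= b /\ c t = x].

(* Curves are total functions on the line, but only their restrictions to
   the unit interval matter. *)
Definition arc_system (R : realType) (T : topologicalType) (I : finType)
    (e : I -> R -> T) (A : set T) : Prop :=
  [/\ forall i, continuous (e i),
      forall i s t, 0 <= s <= 1 -> 0 <= t <= 1 -> e i s = e i t -> s = t,
      forall i j s t, 0 < s < 1 -> 0 <= t <= 1 -> e i s = e j t -> i = j &
      forall x, A x <-> exists i t, 0 <= t <= 1 /\ e i t = x].

Lemma oarc_sub_carc (R : realType) (T : Type) (c : R -> T) (a b : R) :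
  oarc c a b `<=` carc c a b.
Proof. by move=> _ [t [tE <-]]; exists t; split => //; lra. Qed.

Lemma carcE (R : realType) (T : Type) (c : R -> T) (a b : R) :
  carc c a b = [set c t | t in `[a, b]].
Proof.
apply/seteqP; split => [_ [t [tE <-]]|_ [t /= tE <-]].
  by exists t => //=; rewrite in_itv.
by exists t; split => //; move: tE; rewrite in_itv.
Qed.

Lemma oarcE (R : realType) (T : Type) (c : R -> T) (a b : R) :
  oarc c a b = [set c t | t in `]a, b[].
Proof.
apply/seteqP; split => [_ [t [tE <-]]|_ [t /= tE <-]].
  by exists t => //=; rewrite in_itv.
by exists t; split => //; move: tE; rewrite in_itv.
Qed.

Lemma finite_closed (T : topologicalType) (A : set T) :
  hausdorff_space T -> finite_set A -> closed A.
Proof.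
by move=> /hausdorff_accessible; rewrite accessible_finite_set_closed; exact.
Qed.

Section Curve.
Variables (R : realType) (T : topologicalType) (c : R -> T).
Hypothesis c_cont : continuous c.

Lemma carc_compact a b : compact (carc c a b).
Proof.
rewrite carcE; apply: continuous_compact; last exact: segment_compact.
exact: continuous_subspaceT.
Qed.

Lemma carc_connected a b : connected (carc c a b).
Proof.
rewrite carcE; apply: connected_continuous_connected.
  exact: segment_connected.
exact: continuous_subspaceT.
Qed.

Lemma oarc_connected a b : connected (oarc c a b).
Proof.
rewrite oarcE; apply: connected_continuous_connected.
  by apply/connected_intervalP; exact: interval_is_interval.
exact: continuous_subspaceT.
Qed.

End Curve.

Section ArcSystem.
Variables (R : realType) (T : topologicalType) (I : finType) (e : I -> R -> T).
Hypotheses (T_hausdorff : hausdorff_space T) (eS : arc_system e [set: T]).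

Lemma arc_cont i : continuous (e i). Proof. by case: eS. Qed.

Lemma arc_inj i s t : 0 <= s <= 1 -> 0 <= t <= 1 -> e i s = e i t -> s = t.
Proof. by case: eS => _ + _ _; exact. Qed.

Lemma arc_inner i j s t : 0 < s < 1 -> 0 <= t <= 1 -> e i s = e j t ->
  i = j /\ s = t.
Proof.
move=> s01 t01 E; have ij : i = j by case: eS => _ _ H _; exact: (H i j s t).
by split => //; move: E; rewrite -ij; apply: arc_inj => //; lra.
Qed.

Lemma arc_cover x : exists i t, 0 <= t <= 1 /\ e i t = x.
Proof. by case: eS => _ _ _ H; have [H1 _] := H x; exact: H1. Qed.

Lemma carc_closed i a b : closed (carc (e i) a b).
Proof. by apply: compact_closed => //; apply: carc_compact;
  exact: arc_cont. Qed.

(** The complement is a finite union of compact arcs: all other edges and the two remaining pieces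
    of edge [i]. *)
Lemma oarc_open i a b : 0 <= a -> b <= 1 -> open (oarc (e i) a b).
Proof.
move=> a0 b1; rewrite -[oarc _ _ _]setCK openC.
pose Z j := if j == i then carc (e i) 0 a `|` carc (e i) b 1 else carc (e j) 0
  1.
rewrite (_ : ~` _ = \bigcup_(j in [set: I]) Z j).
  apply: closed_bigcup => [|j _]; first exact: finite_finset.
  rewrite /Z; case: ifP => _; last exact: carc_closed.
  by apply: closedU; exact: carc_closed.
apply/seteqP; split => [x nx|x [j _ Zx] [t [tE tx]]].
  have [j [t [tE tx]]] := arc_cover x; exists j => //; rewrite /Z.
  case: eqP => [ji|_]; last by exists t.
  subst j; have [ta|ta] := lerP t a; first by left; exists t; split => //; lra.
  right; exists t; split => //; have [bt|bt] := lerP b t; first by lra.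
  by exfalso; apply: nx; exists t; split => //; lra.
move: Zx; rewrite /Z; case: eqP => [_|ji].
  case=> -[u [uE ux]]; have [|||_ E] := @arc_inner i i t u;
  by rewrite ?ux ?tx//; lra.
move=> [u [uE ux]]; have [|||E _] := @arc_inner i j t u; rewrite ?ux ?tx//;
  try lra.
by apply: ji.
Qed.

(** Since both end points are missed, [C] meets the open and the closed arc between them in the same
    set, which is therefore clopen in [C]. *)
Lemma connected_gap (C : set T) i q r t : connected C -> 0 <= q -> r <= 1 ->
  ~ C (e i q) -> ~ C (e i r) -> q < t < r -> C (e i t) -> C `<=` oarc (e i) q r.
Proof.
move=> Cc q0 r1 Cq Cr tE Ct.
have -> : C = C `&` oarc (e i) q r.
  apply/esym/Cc.
  - by exists (e i t); split => //; exists t.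
  - by exists (oarc (e i) q r) => //; exact: oarc_open.
  - exists (carc (e i) q r); first exact: carc_closed.
    apply/seteqP; split => [x [Cx xo]|x [Cx [u [uE ux]]]].
      by split => //; exact: oarc_sub_carc.
    split => //; exists u; split => //.
    have uq : u != q by apply/eqP => E; apply: Cq; rewrite -E ux.
    have ur : u != r by apply/eqP => E; apply: Cr; rewrite -E ux.
    by rewrite !lt_neqAle eq_sym uq ur.
exact: subIsetr.
Qed.

Lemma arc_near (U : set T) i t : open U -> U (e i t) ->
  \forall u \near t, U (e i u).
Proof. by move=> Uo Ut; apply: (@arc_cont i t); exact: open_nbhs_nbhs. Qed.

Lemma arc_dense (U : set T) : open U -> U !=set0 ->
  exists i t, 0 < t < 1 /\ U (e i t).
Proof.
move=> Uo [x Ux]; have [i [t [tE tx]]] := arc_cover x.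
rewrite -tx in Ux; have := arc_near Uo Ux.
have [t0|t0] := ltrP 0 t; have [t1|t1] := ltrP t 1.
- by move=> _; exists i, t; rewrite t0 t1.
- move=> nt; have : \forall u \near t^'-, U (e i u) by apply:
    (@cvg_within _ (nbhs t)); exact: nt.
  move=> nt'; near t^'- => u; exists i, u; split; last by near: u.
  apply/andP; split; first by near: u; exact: nbhs_left_gt.
  by apply: lt_le_trans (_ : t <= 1); [near: u; exact: nbhs_left_lt|lra].
- move=> nt; have : \forall u \near t^'+, U (e i u) by apply:
    (@cvg_within _ (nbhs t)); exact: nt.
  move=> nt'; near t^'+ => u; exists i, u; split; last by near: u.
  apply/andP; split; last by near: u; exact: nbhs_right_lt.
  by apply: le_lt_trans (_ : 0 <= t) _; [lra|near: u; exact: nbhs_right_gt].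
- by move=> _; exfalso; lra.
Unshelve. all: by end_near. Qed.

Lemma open_sub_arc (U : set T) : open U -> U !=set0 ->
  exists i a b, [/\ 0 < a, a < b, b < 1 & carc (e i) a b `<=` U].
Proof.
move=> Uo U0; have [i [t [tE Ut]]] := arc_dense Uo U0.
have := arc_near Uo Ut.
move=> /nbhs_ballP[/= d d0 dU].
have m0 : 0 < Num.min d (Num.min t (1 - t)) / 2.
  by rewrite divr_gt0// !lt_min d0; lra.
set m := Num.min _ _ in m0.
have [md mt m1] : [/\ m <= d, m <= t & m <= 1 - t].
  by split; rewrite /m !ge_min ?lexx ?orbT.
exists i, (t - m / 2), (t + m / 2); split; try lra.
move=> _ [u [uE <-]]; apply: dU.
by rewrite /ball/= ltr_norml; lra.
Qed.

(* The removed point is an end of the arc that enters [C] there. *)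
Lemma connected_remove_end (C : set T) i a b : connected C ->
  0 < a -> a < b -> b <= 1 -> (forall t, 0 < t < a -> ~ C (e i t)) ->
  (forall t, a <= t < b -> C (e i t)) -> connected (C `\ e i a).
Proof.
move=> Cc a0 ab b1 Clo Chi B B0 [V Vo BV] [K Kc BK].
have closed_pt : closed [set e i a].
  rewrite (_ : [set _] = carc (e i) a a); first exact: carc_closed.
  apply/seteqP; split => [_ ->|_ [t [tE <-]]]; first by exists a; split => //;
    lra.
  by have -> : t = a by lra.
have Co : C `&` oarc (e i) 0 b = e i @` [set t | a <= t < b].
  apply/seteqP; split => [x [Cx [t [tE tx]]]|_ [t /= tE <-]].
    exists t => //=; have [//|ta] := lerP a t; first by lra.
    by exfalso; apply: (Clo t); rewrite ?tx//; lra.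
  by split; [exact: Chi|exists t; split => //; lra].
have ne t : a < t < b -> e i t <> e i a.
  move=> tE E; have : t = a by apply: (arc_inj _ _ E); lra.
  by lra.
have AC : oarc (e i) a b `<=` C `\ e i a.
  move=> _ [t [tE <-]]; split; last by apply: ne.
  by apply: Chi; lra.
(* The connected open arc next to the removed end is contained in [B] or disjoint from it. In the
   first case [B] with the end put back is clopen in [C]; in the second [B] itself is, which forces
   the absurd [B = C]. *)
have [AB|AB] := pselect (oarc (e i) a b `<=` B).
  suff E : B `|` [set e i a] = C.
    apply/seteqP; split=> x; first by rewrite BV => -[].
    by move=> [Cx xne]; move: Cx; rewrite -E => -[].
  apply: Cc; first by case: B0 => x Bx; exists x; left.
  - exists (V `|` oarc (e i) 0 b).
      by apply: openU => //; apply: oarc_open; lra.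
    rewrite setIUr Co BV; apply/seteqP; split => x.
      case=> [[[Cx _] Vx]|->]; first by left.
      by right; exists a => //=; lra.
    case=> [[Cx Vx]|[t /= tE <-]].
      by have [->|xne] := pselect (x = e i a); [right|left].
    have [->|tne] := eqVneq t a; first by right.
    left; suff : B (e i t) by rewrite BV.
    apply: AB; exists t; split => //.
    by rewrite lt_neqAle eq_sym tne; lra.
  - exists (K `|` [set e i a]); first exact: closedU.
    rewrite setIUr BK; apply/seteqP; split => x.
      case=> [[[Cx _] Kx]|->]; first by left.
      by right; split => //; apply: Chi; lra.
    case=> [[Cx Kx]|[_ ->]]; last by right.
    by have [->|xne] := pselect (x = e i a); [right|left].
have {}AB : oarc (e i) a b `&` B = set0.
  apply: contrapT => /eqP/set0P AB0; apply: AB.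
  suff <- : oarc (e i) a b `&` B = oarc (e i) a b by exact: subIsetr.
  have Ac := @oarc_connected R T (e i) (@arc_cont i) a b.
  apply: Ac => //.
    exists V => //; rewrite BV; apply/seteqP; split => x.
      by move=> [? [_ ?]].
    by move=> [Ax Vx]; split => //; split => //; apply: AC.
  exists K => //; rewrite BK; apply/seteqP; split => x.
    by move=> [? [_ ?]].
  by move=> [Ax Vx]; split => //; split => //; apply: AC.
have BC : B = C.
  apply: Cc => //.
    exists (V `\ e i a); first by apply: openI => //; exact: closed_openC.
    rewrite BV; apply/seteqP; split => x; first by move=> [[]].
    by move=> [Cx []].
  exists (K `\` oarc (e i) 0 b).
    by apply: closedI => //; apply: open_closedC; apply: oarc_open; lra.
  apply/seteqP; split => x.
    move=> Bx; move: (Bx); rewrite [in X in X -> _]BK => -[[Cx xne] Kx].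
    split => //; split => // xo.
    have : (C `&` oarc (e i) 0 b) x by [].
    rewrite Co => -[t /= tE tx]; have [E|tne] := eqVneq t a.
      by apply: xne; rewrite -tx E.
    suff : (oarc (e i) a b `&` B) x by rewrite AB.
    split => //; exists t; split => //.
    by rewrite lt_neqAle eq_sym tne; lra.
  move=> [Cx [Kx xo]]; rewrite BK; split => //; split => // xe.
  by apply: xo; exists a; split => //; lra.
exfalso; have : B (e i a) by rewrite BC; apply: Chi; lra.
by rewrite BV => -[[_ ne'] _]; exact: ne'.
Qed.

End ArcSystem.

(** * Arcs under mixing maps *)

Lemma continuous_iter (T : topologicalType) (f : T -> T) n :
  continuous f -> continuous (iter n f).
Proof.
move=> cf; elim: n => [|n IH] x; first exact: cvg_id.
by apply: (@continuous_comp _ _ _ (iter n f) f); [exact: IH|exact: cf].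
Qed.

Section Cover.
Variables (T : Type) (f : T -> T).

Definition covers n (A B : set T) := B `<=` iter n f @` A.

Lemma covers_trans m n A B C : covers m A B -> covers n B C ->
  covers (n + m) A C.
Proof.
move=> AB BC x /BC[y /AB[z Az <-] <-]; exists z => //.
by rewrite iterD.
Qed.

Lemma covers_mul n A k : covers n A A -> covers (k * n) A A.
Proof.
move=> AA; elim: k => [|k IH]; first by move=> x; exists x.
by rewrite mulSn; exact: covers_trans IH AA.
Qed.

End Cover.

Lemma ord3P (P : 'I_3 -> Prop) : P ord0 -> P (lift ord0 ord0) -> P ord_max ->
  forall c, P c.
Proof.
move=> P0 P1 P2 [[|[|[|//]]] lt].
- by rewrite (_ : Ordinal lt = ord0) //; apply: val_inj.
- by rewrite (_ : Ordinal lt = lift ord0 ord0) //; apply: val_inj.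
- by rewrite (_ : Ordinal lt = ord_max) //; apply: val_inj.
Qed.

(** Each row omits at most one column, so a row omitting [u] contains both other columns and reaches
    [u] through any of them related to [u]. The cases record which rows omit the first column; the
    second one serves where the first fails. *)
Lemma ord3_universal (r : rel 'I_3) :
  (forall c d d', d != d' -> r c d || r c d') ->
  exists u, forall c, r c u || [exists k, r c k && r k u].
Proof.
set a : 'I_3 := ord0; set b : 'I_3 := lift ord0 ord0; set z : 'I_3 := ord_max.
move=> H.
have row c : [/\ r c a || r c b, r c a || r c z & r c b || r c z].
  by split; exact: H.
have step c k u : r c k -> r k u -> r c u || [exists k, r c k && r k u].
  by move=> ck ku; apply/orP; right; apply/existsP; exists k; rewrite ck.
have [[a1 a2 a3] [b1 b2 b3] [z1 z2 z3]] := And3 (row a) (row b) (row z).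
have [[uP|uP] |] := pselect (((r a a /\ r b a) /\ r z a) \/
  ((r a b /\ r b b) /\ r z b)).
- by case: uP => -[h1 h2] h3; exists a; apply: ord3P;
    rewrite -/a -/b -/z ?h1 ?h2 ?h3.
- by case: uP => -[h1 h2] h3; exists b; apply: ord3P;
    rewrite -/a -/b -/z ?h1 ?h2 ?h3.
move=> nu.
have [za|nza] := boolP (r z a); have [ba|nba] := boolP (r b a);
 have [aa|naa] := boolP (r a a).
- by exfalso; apply: nu; left.
- rewrite (negbTE naa)/= in a1 a2; exists a.
  by apply: ord3P; rewrite -/a -/b -/z ?za ?ba// (step _ _ _ a1 ba).
- rewrite (negbTE nba)/= in b1 b2; exists a.
  by apply: ord3P; rewrite -/a -/b -/z ?za ?aa// (step _ _ _ b2 za).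
- rewrite (negbTE naa)/= in a1 a2; rewrite (negbTE nba)/= in b1 b2; exists a.
  by apply: ord3P; rewrite -/a -/b -/z ?za// ?(step _ _ _ a2 za)//
    (step _ _ _ b2 za).
- rewrite (negbTE nza)/= in z1 z2; exists a.
  by apply: ord3P; rewrite -/a -/b -/z ?ba ?aa// (step _ _ _ z1 ba).
- rewrite (negbTE naa)/= in a1 a2; rewrite (negbTE nza)/= in z1 z2; exists a.
  by apply: ord3P; rewrite -/a -/b -/z ?ba// ?(step _ _ _ a1 ba)//
    (step _ _ _ z1 ba).
- rewrite (negbTE nba)/= in b1 b2; rewrite (negbTE nza)/= in z1 z2.
  have [ab|nab] := boolP (r a b); first by exfalso; apply: nu; right.
  exists b; apply: ord3P; rewrite -/a -/b -/z ?b1 ?z1 //.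
  by rewrite (negbTE nab)/= in a3; rewrite (step _ _ _ a3 z1).
- by exfalso; apply: nu; right; rewrite (negbTE naa)/= in a1;
  rewrite (negbTE nba)/= in b1; rewrite (negbTE nza)/= in z1.
Qed.

Section SubArc.
Variables (R : realType) (a b : R) (M : nat).

(** Of the [M.*2] equal pieces of [[a, b]] those with even index are kept; the others are gaps that
    keep the kept pieces apart and away from [b]. *)
Definition sub_lo (j : nat) : R := a + (b - a) * (j.*2%:R / M.*2%:R).
Definition sub_hi (j : nat) : R := a + (b - a) * (j.*2.+1%:R / M.*2%:R).

Lemma sub_arc_range j : a < b -> (j < M)%N ->
  [/\ a <= sub_lo j, sub_lo j < sub_hi j & sub_hi j < b].
Proof.
move=> ab jM; have M0 : (0 : R) < M.*2%:R by rewrite ltr0n; lia.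
have ba : 0 < b - a by lra.
split; rewrite /sub_lo /sub_hi.
- by rewrite lerDl mulr_ge0// ?divr_ge0//; lra.
- by rewrite ltrD2l ltr_pM2l// ltr_pM2r ?invr_gt0// ltr_nat.
- rewrite -ltrBrDl -[ltRHS]mulr1 ltr_pM2l// ltr_pdivrMr// mul1r ltr_nat; lia.
Qed.

Lemma sub_arc_lt j k : a < b -> (j < k < M)%N -> sub_hi j < sub_lo k.
Proof.
move=> ab /andP[jk kM]; have M0 : (0 : R) < M.*2%:R by rewrite ltr0n; lia.
rewrite /sub_lo /sub_hi ltrD2l ltr_pM2l ?subr_gt0// ltr_pM2r ?invr_gt0//
  ltr_nat.
by lia.
Qed.

End SubArc.

Section MixingArcs.
Variables (R : realType) (T : topologicalType) (I : finType) (e : I -> R -> T).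
Hypotheses (T_hausdorff : hausdorff_space T) (eS : arc_system e [set: T]).
Variable f : T -> T.
Hypotheses (f_cont : continuous f) (f_mix : mixing f).

Lemma mixing_near (A U V : set T) : open U -> U !=set0 -> U `<=` A ->
  open V -> V !=set0 -> \forall n \near \oo, (iter n f @` A) `&` V !=set0.
Proof.
move=> Uo U0 UA Vo V0; have [N [_ H]] := f_mix Uo Vo U0 V0.
exists N => // n /= Nn; have [_ [[x Ux <-] Vx]] := H n Nn.
by exists (iter n f x); split => //; exists x => //; exact: UA.
Qed.

Lemma oarc_neq0 i a b : a < b -> oarc (e i) a b !=set0.
Proof. by move=> ab; exists (e i ((a + b) / 2)), ((a + b) / 2); split => //;
  lra. Qed.

Lemma mixing_arc_near i a b (V : set T) : 0 <= a -> a < b -> b <= 1 ->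
  open V -> V !=set0 ->
  \forall n \near \oo, (iter n f @` carc (e i) a b) `&` V !=set0.
Proof.
move=> a0 ab b1; apply: (@mixing_near _ (oarc (e i) a b)).
- exact: (oarc_open T_hausdorff eS).
- exact: oarc_neq0.
- exact: oarc_sub_carc.
Qed.

Lemma iter_arc_connected n i a b : connected (iter n f @` carc (e i) a b).
Proof.
apply: connected_continuous_connected.
  exact: (carc_connected (@arc_cont _ _ _ _ eS i)).
exact/continuous_subspaceT/continuous_iter.
Qed.

(* For large n the connected set f^n(A) meets both components left by two
   disjoint subarcs of an edge, so it cannot miss points of both subarcs. *)
Lemma mixing_covers_pair i a b j c d c' d' : 0 <= a -> a < b -> b <= 1 ->
  0 < c -> c < d -> d < c' -> c' < d' -> d' < 1 ->
  \forall n \near \oo, covers f n (carc (e i) a b) (carc (e j) c d) \/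
                       covers f n (carc (e i) a b) (carc (e j) c' d').
Proof.
move=> a0 ab b1 c0 cd dc cd' d1.
have Oo x y : 0 <= x -> x < y -> y <= 1 ->
    \forall n \near \oo, (iter n f @` carc (e i) a b) `&` oarc (e j) x y !=set0.
  move=> x0 xy y1; apply: mixing_arc_near => //.
    exact: (oarc_open T_hausdorff eS).
  exact: oarc_neq0.
have nl : \forall n \near \oo, (iter n f @` carc (e i) a b) `&` oarc (e j) 0 c
  !=set0.
  by apply: Oo; lra.
have nm : \forall n \near \oo, (iter n f @` carc (e i) a b) `&` oarc (e j) d c'
  !=set0.
  by apply: Oo; lra.
near=> n.
have [x [Cx [s [sE sx]]]] : (iter n f @` carc (e i) a b) `&` oarc (e j) 0 c
  !=set0.
  by near: n.
have [y [Cy [t [tE ty]]]] : (iter n f @` carc (e i) a b) `&` oarc (e j) d c'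
  !=set0.
  by near: n.
apply: contrapT => /not_orP[/existsNP[q /not_implyP[[u [uE uq]] Cu]]].
move=> /existsNP[r /not_implyP[[v [vE vr]] Cv]].
have Cuv : iter n f @` carc (e i) a b `<=` oarc (e j) u v.
  apply: (@connected_gap _ _ _ _ T_hausdorff eS _ j u v t);
    rewrite ?uq ?vr ?ty//; try lra.
  exact: iter_arc_connected.
have [w [wE wx]] := Cuv x Cx.
have [|||_ E] := @arc_inner _ _ _ _ eS j j s w; rewrite ?sx ?wx //; lra.
Unshelve. all: by end_near. Qed.

Lemma mixing_covers_family i a b j c d M : 0 <= a -> a < b -> b <= 1 ->
  0 < c -> c < d -> d <= 1 ->
  let A k := carc (e j) (sub_lo c d M k) (sub_hi c d M k) in
  \forall n \near \oo, forall k l : 'I_M, k != l ->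
     covers f n (carc (e i) a b) (A k) \/ covers f n (carc (e i) a b) (A l).
Proof.
move=> a0 ab b1 c0 cd d1 A.
apply: filter_forall => k; apply: filter_forall => l.
wlog kl : k l / (k < l)%N => [H|].
  have [kl|lk|E] := ltngtP k l; first exact: H.
    apply: filterS (H l k lk) => n Hn kl.
    have [|?|?] := Hn; first by rewrite eq_sym.
      by right.
    by left.
  by apply: nearW => n /eqP; case; exact: val_inj.
have [k1 k2 k3] := sub_arc_range cd (ltn_ord k).
have [l1 l2 l3] := sub_arc_range cd (ltn_ord l).
have kl' : sub_hi c d M k < sub_lo c d M l by apply: sub_arc_lt; rewrite ?kl/=.
have : \forall n \near \oo,
    covers f n (carc (e i) a b) (A k) \/ covers f n (carc (e i) a b) (A l).
  by apply: mixing_covers_pair => //; lra.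
by apply: filterS => n + _.
Qed.

(** Every arc eventually covers at least two of three disjoint subarcs. Fixing one common time for
    the three subarcs themselves gives a relation to which [ord3_universal] applies; any other arc
    first covers one of the three and continues from there. *)
Lemma universal_arc i a b : 0 < a -> a < b -> b < 1 ->
  exists a' b', [/\ a <= a', a' < b', b' <= b &
    forall j c d, 0 <= c -> c < d -> d <= 1 -> exists2 s, (0 < s)%N &
      covers f s (carc (e j) c d) (carc (e i) a' b')].
Proof.
move=> a0 ab b1; pose J k := carc (e i) (sub_lo a b 3 k) (sub_hi a b 3 k).
have Jr k : (k < 3)%N -> [/\ a <= sub_lo a b 3 k,
    sub_lo a b 3 k < sub_hi a b 3 k & sub_hi a b 3 k < b].
  exact: sub_arc_range.
have b1' : b <= 1 by lra.
have fam j c d : 0 <= c -> c < d -> d <= 1 ->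
  \forall n \near \oo, forall k l : 'I_3,
    k != l -> covers f n (carc (e j) c d) (J k) \/ covers f n (carc (e j) c d)
      (J l).
  by move=> ? ? ?; exact: mixing_covers_family.
have : \forall n \near \oo, forall c k l : 'I_3,
    k != l -> covers f n (J c) (J k) \/ covers f n (J c) (J l).
  by apply: filter_forall => c; have [? ? ?] := Jr c (ltn_ord c); apply: fam;
    lra.
move=> [N _ NH]; have {}NH := NH N.+1 (leqnSn N).
pose r (c k : 'I_3) := `[< covers f N.+1 (J c) (J k) >].
have [|u uP] := @ord3_universal r.
  move=> c k l /(NH c)[?|?]; apply/orP; [left|right]; exact/asboolP.
have [u1 u2 u3] := Jr u (ltn_ord u).
exists (sub_lo a b 3 u), (sub_hi a b 3 u); split => //; first by lra.
have Ju (c : 'I_3) : exists s, covers f s (J c) (J u).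
  have /orP[/asboolP|/existsP[k /andP[/asboolP ck /asboolP ku]]] := uP c.
    by exists N.+1.
  by exists (N.+1 + N.+1)%N; exact: covers_trans ck ku.
move=> j c d c0 cd d1; have [N' _ N'H] := fam j c d c0 cd d1.
have H : (ord0 : 'I_3) != ord_max by [].
have [C|C] := N'H N'.+1 (leqnSn N') _ _ H.
  by have [s Cs] := Ju ord0; exists (s + N'.+1)%N;
    [by rewrite addnS|exact: covers_trans C Cs].
by have [s Cs] := Ju ord_max; exists (s + N'.+1)%N;
  [by rewrite addnS|exact: covers_trans C Cs].
Qed.

(* With J <= f^k(J), each residue class mod k has at most one of k + 1 disjoint
   subarcs of J that its images never cover, so some subarc is good for all. *)
Lemma recurrent_arc i a b : 0 < a -> a < b -> b < 1 ->
  exists a' b', [/\ a <= a', a' < b', b' <= b &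
    \forall n \near \oo, covers f n (carc (e i) a' b') (carc (e i) a' b')].
Proof.
move=> a0 ab b1; have [c [d [ac cd db Juniv]]] := universal_arc i a0 ab b1.
pose J := carc (e i) c d; have c0 : 0 < c by lra.
have [c0' d1] : 0 <= c /\ d <= 1 by lra.
have [k k0 Jk] := Juniv i c d c0' cd d1.
pose A j := carc (e i) (sub_lo c d k.+1 j) (sub_hi c d k.+1 j).
have [N1 _ N1H] := @mixing_covers_family i c d i c d k.+1 c0' cd d1 c0 cd d1.
have [j jP] : exists j : 'I_k.+1, forall r : 'I_k, exists n,
    covers f (n * k + r) J (A j).
  apply: contrapT => /forallNP noj.
  have bad (j : 'I_k.+1) : exists r : 'I_k, forall n,
    ~ covers f (n * k + r) J (A j).
    by have /existsNP[r /forallNP rP] := noj j; exists r.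
  pose rho j := projT1 (cid (bad j)).
  have rhoP j : forall n, ~ covers f (n * k + rho j) J (A j).
    by rewrite /rho; case: cid.
  have /injectivePn[j [l jl E]] : ~~ injectiveb rho.
    by apply/negP => /injectiveP/leq_card; rewrite !card_ord ltnn.
  have le : (N1 <= N1 * k + rho j)%N by rewrite (leq_trans (leq_pmulr N1 k0))//
    leq_addr.
  by case: (N1H _ le j l jl) => H;
    [apply: (rhoP j)|apply: (rhoP l); rewrite -E]; exact: H.
have [j1 j2 j3] := sub_arc_range cd (ltn_ord j).
have AJ : A j `<=` J.
  by move=> _ [t [tE <-]]; exists t; split => //; lra.
have [|||s _ sP] := Juniv i (sub_lo c d k.+1 j) (sub_hi c d k.+1 j); try lra.
exists (sub_lo c d k.+1 j), (sub_hi c d k.+1 j); split; try lra.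
(* One time [n_ r * k + r] per residue is enough: loops of length [k] from [J] to itself lead from
   it to every later time of the same residue. The initial [s] steps take [A j] over [J]. *)
pose n_ r := projT1 (cid (jP r)).
have n_P r : covers f (n_ r * k + r) J (A j) by rewrite /n_; case: cid.
set M := \max_r n_ r; exists (s + k * M.+1)%N => // n /= nE.
have sn : (s <= n)%N by exact: leq_trans (leq_addr _ _) nE.
have nM : (M <= (n - s) %/ k)%N.
  rewrite leq_divRL// leq_subRL//; apply: leq_trans nE.
  by rewrite leq_add2l mulnC leq_mul2l leqnSn orbT.
rewrite -(subnK sn); apply: covers_trans sP _.
have ltr : ((n - s) %% k < k)%N by rewrite ltn_mod.
pose r := Ordinal ltr.
have le : (n_ r <= (n - s) %/ k)%N by apply: leq_trans nM; exact: leq_bigmax.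
rewrite (divn_eq (n - s) k) -(subnK le) mulnDl -addnA addnC.
apply: covers_trans (n_P r).
exact: covers_mul.
Qed.

End MixingArcs.

(** * Exhaustion of the graph by the images of an arc *)

Section Split.
Variables (R : realType).

(* The two halves of the unit interval cut at [c], each travelled from the
   outer end towards [c]. *)
Definition half_par (c : R) (b : bool) (t : R) : R :=
  if b then 1 - (1 - c) * t else c * t.

Lemma half_par_cont c b : continuous (half_par c b).
Proof.
move=> t; case: b => /=.
  by apply: cvgB; [exact: cvg_cst|apply: cvgM; [exact: cvg_cst|exact: cvg_id]].
by apply: cvgM; [exact: cvg_cst|exact: cvg_id].
Qed.

Lemma half_par01 c b t : 0 < c < 1 -> 0 <= t <= 1 -> 0 <= half_par c b t <= 1.
Proof. by case: b => /= c01 t01; apply/andP; split; nra. Qed.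

Lemma half_par_inner c b t : 0 < c < 1 -> 0 < t < 1 ->
  if b then c < half_par c b t < 1 else 0 < half_par c b t < c.
Proof. by case: b => /= c01 t01; apply/andP; split; nra. Qed.

Lemma half_par_side c b t : 0 < c < 1 -> 0 <= t <= 1 ->
  if b then c <= half_par c b t else half_par c b t <= c.
Proof. by case: b => /= c01 t01; nra. Qed.

Lemma half_par_inj c b : 0 < c < 1 -> injective (half_par c b).
Proof.
move=> c01 s t; case: b => /= E.
  have /mulfI : 1 - c != 0 by rewrite gt_eqF; lra.
  by apply; lra.
by apply: (@mulfI _ c) => //; rewrite gt_eqF; lra.
Qed.

Variables (T : topologicalType) (I : finType) (e : I -> R -> T) (c : I -> R).

Definition split_arcs (p : I * bool) (t : R) : T :=
  e p.1 (half_par (c p.1) p.2 t).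

Hypotheses (eS : arc_system e [set: T]) (c01 : forall i, 0 < c i < 1).

Lemma split_arc_system : arc_system split_arcs [set: T].
Proof.
split.
- move=> [i b] t; apply: (@continuous_comp _ _ _ (half_par (c i) b) (e i)).
    exact: half_par_cont.
  exact: (arc_cont eS).
- move=> [i b] s t sE tE /= E; apply: (@half_par_inj (c i) b) => //.
  by apply: (arc_inj eS) E; exact: half_par01.
- move=> [i b] [j b'] s t sE tE /= E.
  have si := half_par_inner b (c01 i) sE;
    have tj := half_par_side b' (c01 j) tE.
  have ci := c01 i.
  have [||ij Est] := @arc_inner _ _ _ _ eS i j (half_par (c i) b s)
    (half_par (c j) b' t) _ _ E.
  + by case: (b) si => ?; lra.
  + exact: half_par01.
  subst j; congr (_, _); rewrite Est in si.
  by case: (b) (b') si tj => -[]// ? ?; lra.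
move=> x; split => // _.
have [i [t [tE tx]]] := arc_cover eS x; have ci := c01 i.
have [tc|ct] := lerP t (c i).
  exists (i, false), (t / c i); rewrite /split_arcs/=; split.
    by rewrite divr_ge0 ?ler_pdivrMr; lra.
  by rewrite mulrC divfK// gt_eqF; lra.
exists (i, true), ((1 - t) / (1 - c i)); rewrite /split_arcs/=; split.
  by rewrite divr_ge0 ?ler_pdivrMr; lra.
rewrite mulrC divfK; first by rewrite opprB addrCA subrr addr0.
by rewrite gt_eqF; lra.
Qed.

End Split.

(* F n stands for f^n(J), where the arc J satisfies J <= f^n(J) for all large
   n; only the end 0 of a leg may fail to be reached by the sets F n. *)
Definition leg_exhaustion (R : realType) (T : topologicalType) (f : T -> T)
    (L : finType) (g : L -> R -> T) (F : nat -> set T) : Prop :=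
  [/\ arc_system g [set: T],
      forall n, F n.+1 = f @` F n,
      forall n, closed (F n) /\ connected (F n),
      forall n, F n <> [set: T] /\ \forall n' \near \oo, F n `<=` F n' &
      forall l (d : R), 0 < d -> \forall n \near \oo, carc (g l) d 1 `<=` F n].

Section Exhaustion.
Variables (R : realType) (T : topologicalType) (I : finType) (e : I -> R -> T).
Hypotheses (T_hausdorff : hausdorff_space T) (eS : arc_system e [set: T]).
Variable f : T -> T.
Hypotheses (f_cont : continuous f) (f_mix : mixing f).
Variable J : set T.
Hypothesis J_arc : exists i (a b : R),
  [/\ 0 < a, a < b, b < 1 & J = carc (e i) a b].
Hypothesis J_full : forall n, iter n f @` J <> [set: T].
Hypothesis J_rec : \forall n \near \oo, covers f n J J.

Let F n := iter n f @` J.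

Let F_mono n : \forall n' \near \oo, F n `<=` F n'.
Proof.
have [N _ NH] := J_rec; exists (n + N)%N => // n' /= le.
have -> : n' = (n + (n' - n))%N by lia.
move=> _ [x Jx <-]; have [|y Jy <-] := NH (n' - n)%N _ x Jx;
  first by rewrite /=; lia.
by exists y => //; rewrite iterD.
Qed.

Let F_connected n : connected (F n).
Proof.
by have [i [a [b [_ _ _ JE]]]] := J_arc; rewrite /F JE;
  exact: iter_arc_connected.
Qed.

Let F_closed n : closed (F n).
Proof.
apply: compact_closed => //; apply: continuous_compact.
  exact/continuous_subspaceT/continuous_iter.
have [i [a [b [_ _ _ ->]]]] := J_arc; apply: carc_compact; exact: (arc_cont eS).
Qed.

Let F_meets (V : set T) : open V -> V !=set0 ->
  \forall n \near \oo, F n `&` V !=set0.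
Proof.
have [i [a [b [a0 ab b1 JE]]]] := J_arc => Vo V0; rewrite /F JE.
by apply: (mixing_arc_near T_hausdorff eS f_mix) => //; lra.
Qed.

(** Nearness is joint in the parameter and the time; in this form compactness of a closed segment
    yields one time for a whole subarc. *)
Let solid j (t : R) := \forall s \near t & n \near \oo, F n (e j s).

Let near_solid j (t : R) n : (\forall s \near t, F n (e j s)) -> solid j t.
Proof.
move=> ns; exists ([set s | F n (e j s)], [set m | F n `<=` F m]).
  by split => //; exact: F_mono.
by move=> [s m] [/= Fs]; exact.
Qed.

(* Missing points near both q and r would disconnect F n. *)
Let nonsolid_unique j (q r : R) : 0 < q < 1 -> 0 < r < 1 -> ~ solid j q ->
  ~ solid j r -> q = r.
Proof.
wlog qr : q r / q < r => [H|q01 r01 nq nr].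
  have [lt|lt|//] := ltgtP q r; first exact: H.
  by move=> *; apply/esym/H.
exfalso; pose d := (r - q) / 3.
have d0 : 0 < d by rewrite /d; lra.
have Oo x y : 0 <= x -> x < y -> y <= 1 ->
    \forall n \near \oo, F n `&` oarc (e j) x y !=set0.
  move=> x0 xy y1; apply: F_meets.
    exact: (oarc_open T_hausdorff eS).
  exact: oarc_neq0.
have nm : \forall n \near \oo, F n `&` oarc (e j) (q + d) (r - d) !=set0.
  by apply: Oo; rewrite /d; lra.
have nl : \forall n \near \oo, F n `&` oarc (e j) 0 (q / 2) !=set0.
  by apply: Oo; lra.
near \oo => n.
have [y [Fy [t [tE ty]]]] : F n `&` oarc (e j) (q + d) (r - d) !=set0 by near:
  n.
have [x [Fx [s [sE sx]]]] : F n `&` oarc (e j) 0 (q / 2) !=set0 by near: n.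
have miss u (eps : R) : ~ solid j u -> 0 < eps ->
    exists v, u - eps < v < u + eps /\ ~ F n (e j v).
  move=> nu eps0; apply: contrapT => /forallNP H; apply: nu.
  apply: (@near_solid _ _ n); exists eps => //= v uv.
  apply: contrapT => nF; apply: (H v); split => //.
  by move: uv; rewrite /ball/= ltr_norml; lra.
have m0 : 0 < Num.min d (q / 2) by rewrite lt_min d0; lra.
have [md mq] : Num.min d (q / 2) <= d /\ Num.min d (q / 2) <= q / 2.
  by rewrite !ge_min !lexx orbT.
have [u [uE Fu]] := miss q _ nq m0.
have m0' : 0 < Num.min d (1 - r) by rewrite lt_min d0; lra.
have [md' mr] : Num.min d (1 - r) <= d /\ Num.min d (1 - r) <= 1 - r.
  by rewrite !ge_min !lexx orbT.
have [v [vE Fv]] := miss r _ nr m0'.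
have Fuv : F n `<=` oarc (e j) u v.
  apply: (@connected_gap _ _ _ _ T_hausdorff eS _ j u v t) => //; rewrite ?ty//;
    lra.
have [w [wE wx]] := Fuv x Fx.
by have [|||_ E] := @arc_inner _ _ _ _ eS j j s w; rewrite ?sx ?wx //; lra.
Unshelve. all: by end_near. Qed.

Let solid_arc j (a b : R) : (forall t, a <= t <= b -> solid j t) ->
  \forall n \near \oo, carc (e j) a b `<=` F n.
Proof.
move=> sol; have /compact_near_coveringP cov := @segment_compact R a b.
have := cov nat \oo (fun n s => F n (e j s)) _ _.
move=> /(_ _ _)[|N _ NH]; first by move=> t /=; rewrite in_itv => /sol.
exists N => // n Nn _ [t [tE <-]]; apply: (NH n Nn) => /=.
by rewrite in_itv.
Qed.

Let cut_exists j : exists q, 0 < q < 1 /\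
  forall t, 0 < t < 1 -> t != q -> solid j t.
Proof.
have [[q [q01 nq]]|nn] := pselect (exists q, 0 < q < 1 /\ ~ solid j q).
  exists q; split => // t t01 tq; apply: contrapT => nt.
  by move/eqP: tq; apply; exact: (nonsolid_unique t01 q01 nt nq).
exists (1 / 2); split; first by lra.
by move=> t t01 _; apply: contrapT => nt; apply: nn; exists t.
Qed.

(** Cutting an edge at its only possible bad inner point and then cutting each half at its midpoint
    leaves four legs, oriented so that the cut point [q j] or an end of the edge sits at parameter
    0. *)
Let legs_solid (q : I -> R) : (forall j, 0 < q j < 1) ->
  (forall j t, 0 < t < 1 -> t != q j -> solid j t) ->
  forall l (d : R), 0 < d -> \forall n \near \oo,
    carc (split_arcs (split_arcs e q) (fun=> 1 / 2) l) d 1 `<=` F n.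
Proof.
move=> q01 qP [[j b] b'] d d0; have qj := q01 j.
(* The edge parameters of the points [d / 2] and [1 - d / 2] of the half [b]; the second cut sends
   the part [[d, 1]] of either leg between them. *)
pose lo := if b then 1 - (1 - q j) * (1 - d / 2) else q j * (d / 2).
pose hi := if b then 1 - (1 - q j) * (d / 2) else q j * (1 - d / 2).
have [d1|d1] := lerP d 1; last first.
  by apply: nearW => n x [t [tE _]]; have : t < t by [lra]; rewrite ltxx.
have : \forall n \near \oo, carc (e j) lo hi `<=` F n.
  apply: solid_arc => t tE; have [t01 tb] :
    0 < t < 1 /\ if b then q j < t else t < q j.
    by move: tE; rewrite /lo /hi; case: (b) => /andP[? ?]; split; nra.
  by apply: qP => //; apply/eqP => E; rewrite E in tb; case: (b) tb;
    rewrite ltxx.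
apply: filterS => n + _ [t [tE <-]]; apply; rewrite /split_arcs /=.
eexists; split; last by reflexivity.
have : d / 2 <= half_par (1 / 2) b' t <= 1 - d / 2.
  by case: b' => /=; lra.
by rewrite /lo /hi /half_par; case: (b) => ?; apply/andP; split; nra.
Qed.

Lemma leg_exhaustion_exists : exists (L : finType) (g : L -> R -> T),
  leg_exhaustion f g F.
Proof.
pose q j := projT1 (cid (cut_exists j)).
have q01 j : 0 < q j < 1 by rewrite /q; case: cid => ? [].
have qP j t : 0 < t < 1 -> t != q j -> solid j t by rewrite /q;
  case: cid => ? [_ +] /=; exact.
have h01 : forall p : I * bool, 0 < (1 / 2 : R) < 1 by move=> _; lra.
have sS := split_arc_system eS q01.
exists ((I * bool) * bool)%type, (split_arcs (split_arcs e q) (fun=> 1 / 2)).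
split.
- exact: split_arc_system.
- move=> n; rewrite /F; apply/seteqP; split => [_ [x Jx <-]|_ [_ [x Jx <-] <-]].
    by exists (iter n f x) => //; exists x.
  by exists x.
- by move=> n; split; [exact: F_closed|exact: F_connected].
- by move=> n; split; [exact: J_full|exact: F_mono].
exact: legs_solid.
Qed.

End Exhaustion.

(** * Inaccessible ends and the shape of the images *)

Section Legs.
Variables (R : realType) (T : topologicalType) (f : T -> T).
Variables (L : finType) (g : L -> R -> T) (F : nat -> set T).
Hypotheses (T_hausdorff : hausdorff_space T) (gF : leg_exhaustion f g F).

(** The notion is one-sided, hence the positive parameter: the end [g l 0] may be a vertex that is
    reached through other legs. *)
Definition inaccessible (l : L) : Prop :=
  forall n, exists t, 0 < t <= 1 /\ ~ F n (g l t).

Lemma leg_arcs : arc_system g [set: T]. Proof. by case: gF. Qed.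
Lemma leg_closed n : closed (F n).
Proof. by case: gF => _ _ H _ _; case: (H n). Qed.
Lemma leg_connected n : connected (F n).
Proof. by case: gF => _ _ H _ _; case: (H n). Qed.
Lemma leg_proper n : F n <> [set: T].
Proof. by case: gF => _ _ _ H _; case: (H n). Qed.
Lemma leg_mono n : \forall n' \near \oo, F n `<=` F n'.
Proof. by case: gF => _ _ _ H _; case: (H n). Qed.
Lemma leg_image n : F n.+1 = f @` F n.
Proof. by case: gF. Qed.
Lemma leg_tail l (d : R) : 0 < d ->
  \forall n \near \oo, carc (g l) d 1 `<=` F n.
Proof. by case: gF => _ _ _ _ H; exact: H. Qed.

Let S := leg_arcs.

Lemma carc_end0 (C : set T) l : closed C ->
  (forall t, 0 < t <= 1 -> C (g l t)) ->
  C (g l 0).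
Proof.
move=> Cc H; apply: contrapT => nC.
have Co : open (~` C) by exact: closed_openC.
have [d /= d0 dE] : \forall u \near (0 : R), (~` C) (g l u) by exact:
  (arc_near S).
have m0 : 0 < Num.min d 1 / 2 by rewrite divr_gt0// lt_min d0 ltr01.
have [md m1] : Num.min d 1 <= d /\ Num.min d 1 <= 1 by rewrite !ge_min !lexx
  orbT.
apply: (dE (Num.min d 1 / 2)); last by apply: H; lra.
by rewrite /ball/= sub0r normrN gtr0_norm//; lra.
Qed.

Lemma accessible_full l : ~ inaccessible l ->
  \forall n \near \oo, carc (g l) 0 1 `<=` F n.
Proof.
move=> /existsNP[n H]; have Fn := leg_mono n; apply: filterS Fn => m Fm.
have Hm t : 0 < t <= 1 -> F n (g l t).
  by move=> tE; apply: contrapT => nF; apply: H; exists t.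
move=> _ [t [tE <-]]; apply: Fm; have [->|t0] := eqVneq t 0.
  by apply: carc_end0 => //; exact: leg_closed.
by apply: Hm; rewrite lt_neqAle eq_sym t0.
Qed.

Lemma inaccessible_exists : exists l, inaccessible l.
Proof.
apply: contrapT => /forallNP na.
have : \forall n \near \oo, forall l, carc (g l) 0 1 `<=` F n.
  by apply: filter_forall => l; exact: accessible_full.
move=> [N _ NH]; apply: (@leg_proper N); rewrite -subTset => x _.
have [l [t [tE <-]]] := arc_cover S x; apply: (NH N (leqnn N) l).
by exists t.
Qed.

Lemma no_gap (C : set T) l r s t : connected C -> C (g l 1) ->
  0 <= r -> r < s -> s < t -> t <= 1 -> ~ C (g l r) -> C (g l s) -> C (g l t).
Proof.
move=> Cc C1 r0 rs st t1 Cr Cs; apply: contrapT => Ct.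
have CE : C `<=` oarc (g l) r t.
  by apply: (@connected_gap _ _ _ _ T_hausdorff S _ l r t s) => //; lra.
have [u [uE ux]] := CE _ C1.
by have [|||_ E] := @arc_inner _ _ _ _ S l l u 1; rewrite ?ux//; lra.
Qed.

(** If [F n] came arbitrarily close to the end along the leg, a later image through [g l 1] would by
    [no_gap] contain a whole initial piece of the leg. The rest of the leg is covered later still,
    so the end would be accessible. *)
Lemma inaccessible_miss l n : inaccessible l ->
  exists a, 0 < a < 1 /\ forall t, 0 < t <= a -> ~ F n (g l t).
Proof.
move=> la; apply: contrapT => H.
have Fl s : 0 < s < 1 -> exists t, 0 < t <= s /\ F n (g l t).
  move=> s01; apply: contrapT => /forallNP nt; apply: H; exists s; split => //.
  by move=> t tE Ft; apply: (nt t).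
have Fn := leg_mono n; have F1 := @leg_tail l 1 ltr01.
near \oo => m.
have Fm1 : F m (g l 1).
  suff : carc (g l) 1 1 `<=` F m by apply; exists 1; split => //; lra.
  by near: m.
have Fnm : F n `<=` F m by near: m.
have [t0 [t0E nF0]] := la m.
have [|t1 [t1E /Fnm Ft1]] := Fl (t0 / 2); first lra.
have lo t : 0 < t <= t1 -> F m (g l t).
  move=> tE; apply: contrapT => nFt; apply: nF0.
  have tlt : t < t1 by rewrite lt_neqAle; apply/andP; split;
    [apply/eqP => E; apply: nFt; rewrite E|lra].
  by apply: (@no_gap _ l t t1) => //; first [exact: leg_connected | lra].
have Fm := leg_mono m; have Ft : \forall n \near \oo, carc (g l) t1 1 `<=` F n.
  by apply: leg_tail; lra.
near \oo => k; have [t [tE]] := la k; apply.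
have Fmk : F m `<=` F k by near: k.
have [tt1|t1t] := lerP t t1; first by apply/Fmk/lo; lra.
suff : carc (g l) t1 1 `<=` F k by apply; exists t; split => //; lra.
by near: k.
Unshelve. all: by end_near. Qed.

(** [a] is the level at which [F n] begins on the leg; the bound [1 / 2] leaves a nondegenerate
    piece of the leg inside [F n]. *)
Definition frontier n l (a : R) : Prop :=
  [/\ 0 <= a <= 1 / 2, inaccessible l -> 0 < a, ~ inaccessible l -> a = 0,
      forall t, 0 < t < a -> ~ F n (g l t) & forall t, a <= t <= 1 ->
        F n (g l t)].

Lemma frontier_exists : \forall n \near \oo, forall l, exists a, frontier n l a.
Proof.
apply: filter_forall => l.
have [la|nla] := pselect (inaccessible l); last first.
  apply: filterS (accessible_full nla) => n Fn; exists 0; split => //; try lra.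
    by move=> t tE; have : t < t by [lra]; rewrite ltxx.
  by move=> t tE; apply: Fn; exists t.
have h0 : 0 < (1 / 2 : R) by lra.
apply: filterS (leg_tail l h0) => n Fn.
have Fh t : 1 / 2 <= t <= 1 -> F n (g l t) by move=> tE; apply: Fn; exists t.
have [c [cE nFc]] := inaccessible_miss n la.
pose A := [set t | 0 < t <= 1 /\ F n (g l t)].
have Alb : lbound A c.
  move=> t [tE Ft]; rewrite leNgt; apply/negP => tc.
  by apply: (nFc t) => //; lra.
have Ah : A (1 / 2) by split; [lra|apply: Fh; lra].
have A0 : A !=set0 by exists (1 / 2).
have hA : has_inf A by split => //; exists c.
have cA : c <= inf A by exact: lb_le_inf.
have Ah2 : inf A <= 1 / 2 by apply: ge_inf => //; exists c.
have Fup t : inf A < t <= 1 -> F n (g l t).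
  move=> tE; have [s [sE Fs] st] : exists2 s, A s & s < t.
    by apply: inf_lt => //; lra.
  (* [Num.min c s / 2] is missed because it lies below [c], and it lies to the left of [s]. *)
  apply: (@no_gap _ l (Num.min c s / 2) s) => //; try lra.
  - exact: leg_connected.
  - by apply: Fh; lra.
  - by rewrite divr_ge0// le_min; lra.
  - have : Num.min c s <= s by rewrite ge_min lexx orbT.
    by lra.
  apply: nFc; have : 0 < Num.min c s by rewrite lt_min; lra.
  by have : Num.min c s <= c by [rewrite ge_min lexx]; lra.
exists (inf A); split => //; try lra.
  move=> t tE Ft; have : inf A <= t by apply: ge_inf;
    [exists c|split => //; lra].
  by lra.
(* The infimum itself is reached because [F n] is closed. *)
move=> t tE; have [E|tA] := eqVneq t (inf A); last first.
  by apply: Fup; rewrite lt_neqAle eq_sym tA; lra.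
apply: contrapT => nF; have Co : open (~` F n) by exact/closed_openC/leg_closed.
have ct : \forall u \near t, ~ F n (g l u) by exact: (arc_near S Co nF).
have ct' : \forall u \near t^'+, ~ F n (g l u).
  by apply: (@cvg_within _ (nbhs t)); exact: ct.
near t^'+ => u.
have tu : t < u by near: u; exact: nbhs_right_gt.
have u1 : u < 1 by near: u; apply: nbhs_right_lt; lra.
have : ~ F n (g l u) by near: u.
by apply; apply: Fup; rewrite -E; lra.
Unshelve. all: by end_near. Qed.

Section Frontier.
Variables (n : nat) (a : L -> R).
Hypothesis aP : forall l, frontier n l (a l).

Let a_le l : 0 <= a l <= 1 / 2. Proof. by case: (aP l). Qed.

Let F_frontier l t : a l <= t <= 1 -> F n (g l t).
Proof. by case: (aP l) => _ _ _ _; exact. Qed.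

(** Only a vertex all of whose legs are cut could be left over. It would be isolated in [F n], which
    is connected and has other points. *)
Lemma frontier_cover x : F n x <-> exists l t, a l <= t <= 1 /\ g l t = x.
Proof.
split=> [Fx|[l [t [tE <-]]]]; last exact: F_frontier.
pose Z := \bigcup_(l in [set: L]) carc (g l) (a l) 1.
have Zc : closed Z.
  by apply: closed_bigcup => [|l _];
    [exact: finite_finset|exact: (carc_closed T_hausdorff S)].
suff : Z x by case=> l _ [t [tE tx]]; exists l, t.
apply: contrapT => nZ.
have [l0 [t0 [t0E t0x]]] := arc_cover S x.
pose P := [set y | exists l, g l 0 = y /\ y <> x].
have Pc : closed P.
  apply: finite_closed => //.
  apply: (@sub_finite_set _ _ ((fun l => g l 0) @` [set: L])).
    by move=> y [l [<- _]]; exists l.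
  by apply: finite_image; exact: finite_finset.
have xc : closed [set x].
  by apply: finite_closed => //; exact: finite_set1.
have E : [set x] = F n.
  apply: (leg_connected (n := n)); first by exists x.
  - exists (~` Z `&` ~` P); first by apply: openI; exact: closed_openC.
    apply/seteqP; split => [y ->|y [Fy [nZy nPy]]].
      by split => //; split => // -[l [_]]; exact.
    have [l [t [tE ty]]] := arc_cover S y.
    have [t0'|tn0] := eqVneq t 0.
      by apply: contrapT => yx; apply: nPy; exists l; rewrite -t0' ty.
    exfalso; have [ta|at_] := ltrP t (a l).
      have [_ _ _ H _] := aP l; apply: (H t); last by rewrite ty.
      by apply/andP; split => //; rewrite lt_neqAle eq_sym tn0; case/andP: tE.
    by apply: nZy; exists l => //; exists t; split => //; apply/andP;
      split => //; case/andP: tE.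
  - exists [set x] => //; apply/seteqP; split => [y ->|y []//].
    by split.
have al0 := a_le l0.
have [F1 F2] : F n (g l0 1) /\ F n (g l0 (3 / 4)) by split; apply: F_frontier;
  lra.
rewrite -E in F1 F2; have : (1 : R) = 3 / 4.
  by apply: (arc_inj S (i := l0)); [lra|lra|rewrite F1 F2].
by lra.
Qed.

Lemma frontier_arc_system :
  arc_system (fun l t => g l (a l + (1 - a l) * t)) (F n).
Proof.
have par01 l t : 0 <= t <= 1 -> 0 <= a l + (1 - a l) * t <= 1.
  by move=> tE; have al := a_le l; apply/andP; split; nra.
split.
- move=> l t; apply: (@continuous_comp _ _ _ (fun t =>
    a l + (1 - a l) * t) (g l)).
    apply: cvgD; first exact: cvg_cst.
    by apply: cvgM; [exact: cvg_cst|exact: cvg_id].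
  exact: (arc_cont S).
- move=> l s t sE tE E; have al := a_le l.
  have := arc_inj S (par01 l s sE) (par01 l t tE) E => /addrI.
  have /mulfI : 1 - a l != 0 by rewrite gt_eqF; lra.
  by move=> H /H.
- move=> l l' s t sE tE E; have al := a_le l.
  have [|-> _] := @arc_inner _ _ _ _ S l l' _ _ _ (par01 l' t tE) E => //.
  by apply/andP; split; nra.
move=> x; rewrite frontier_cover; split=> -[l [t [tE tx]]].
  have al := a_le l; exists l, ((t - a l) / (1 - a l)); split.
    by rewrite divr_ge0 ?ler_pdivrMr; lra.
  by rewrite mulrC divfK; [rewrite addrC subrK|rewrite gt_eqF; lra].
have al := a_le l; exists l, (a l + (1 - a l) * t); split => //.
by apply/andP; split; nra.
Qed.

Lemma frontier_inner l l' t : inaccessible l' -> 0 <= t <= 1 ->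
  g l' (a l') = g l t -> l' = l /\ a l' = t.
Proof.
move=> la tE; apply: (arc_inner S) => //; have al := a_le l'.
by have [_ /(_ la) ? _ _ _] := aP l'; lra.
Qed.

(** A cut point is a free end of [F n] and lies on no other leg, so it is still a free end after the
    other cut points are gone. *)
Lemma frontier_removal (s : seq L) : uniq s ->
  {in s, forall l, inaccessible l} ->
  connected (F n `\` [set g l (a l) | l in [set` s]]).
Proof.
elim: s => [|l s IH] /= => [_ _|/andP[ls us] Hs].
  rewrite (_ : F n `\` _ = F n); first exact: leg_connected.
  by apply/seteqP; split => [x []//|x Fx]; split => // -[].
have la : inaccessible l by apply: Hs; rewrite inE eqxx.
have IHs := IH us (fun k ks => Hs k (mem_behead (s := l :: s) ks)).
have al := a_le l; have [_ /(_ la) a0 _ nF Fl] := aP l.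
rewrite (_ : F n `\` _ = (F n `\` [set g l (a l) | l in [set` s]]) `\ g l
  (a l)).
  apply: (connected_remove_end T_hausdorff S (b := 3 / 4)) => //; try lra.
    by move=> t tE [+ _]; exact: nF.
  move=> t tE; split; first by apply: Fl; lra.
  move=> [k /= ks E]; have ka : inaccessible k by apply: Hs;
    rewrite inE ks orbT.
  have [|kl _] := frontier_inner ka _ E; first lra.
  by move: ls; rewrite -kl ks.
apply/seteqP; split => [x [Fx nx]|x [[Fx nx] xl]].
  split; first split => //.
    by move=> [k /= ks E]; apply: nx; exists k => //=; rewrite inE ks orbT.
  by move=> E; apply: nx; exists l => //=; rewrite inE eqxx.
split => // -[k /=]; rewrite inE => /orP[/eqP ->|ks] E.
  by apply: xl; rewrite -E.
by apply: nx; exists k.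
Qed.

End Frontier.
End Legs.

(** * The action on inaccessible ends *)

Lemma at_right0P (R : realType) (P : R -> Prop) :
  (\forall s \near 0^'+, P s) <-> exists2 d, 0 < d & forall s, 0 < s < d -> P s.
Proof.
split=> [[d /= d0 H]|[d d0 H]].
  exists d => // s sd; apply: H; last by lra.
  by rewrite /ball/= sub0r normrN gtr0_norm; lra.
exists d => // s /=; rewrite sub0r normrN => sd s0; apply: H.
by rewrite gtr0_norm// in sd; lra.
Qed.

Lemma mixing_surjective (T : topologicalType) (f : T -> T) :
  hausdorff_space T -> compact [set: T] -> continuous f -> mixing f ->
  f @` [set: T] = [set: T].
Proof.
move=> Th Tc fc fm; rewrite -subTset => x _; apply: contrapT => nx.
have cl : closed (f @` [set: T]).
  by apply: compact_closed => //; apply: continuous_compact => //;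
    exact: continuous_subspaceT.
have [||||N [_ NH]] := fm [set: T] (~` (f @` [set: T])).
- exact: openT.
- exact: closed_openC.
- by exists x.
- by exists x.
by have [_ [[y _ <-]]] := NH N.+1 (leqnSn N); apply; exists (iter N f y).
Qed.

Section Germs.
Variables (R : realType) (T : topologicalType) (f : T -> T).
Variables (L : finType) (g : L -> R -> T) (F : nat -> set T).
Hypotheses (T_hausdorff : hausdorff_space T) (T_compact : compact [set: T]).
Hypotheses (f_cont : continuous f) (f_mix : mixing f).
Hypothesis gF : leg_exhaustion f g F.

Let S := leg_arcs gF.
Local Notation inaccessible := (inaccessible g F).

(** Only some points near the two ends are asked to correspond; for inaccessible [w],
    [germ_invariant] extends this to all points near the end of [v]. *)
Definition leads (v w : L) : Prop := forall eps : R, 0 < eps ->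
  exists t s, [/\ 0 < t < eps, 0 < s < eps & f (g v t) = g w s].

(* Points close to an inaccessible end are outside f(F n), so all their
   preimages are outside F n, that is, close to inaccessible ends. *)
Lemma germ_preimage w (eps : R) : inaccessible w -> 0 < eps ->
  \forall s \near 0^'+, forall x, f x = g w s ->
    exists v t, [/\ inaccessible v, 0 < t < eps & x = g v t].
Proof.
move=> iw eps0.
have : \forall n \near \oo, forall l, carc (g l) eps 1 `<=` F n /\
    (~ inaccessible l -> carc (g l) 0 1 `<=` F n).
  apply: filter_forall => l; apply: filterI; first exact: (leg_tail gF).
  have [il|nil] := pselect (inaccessible l);
    first by exists 0%N => // n _ /(_ il).
  by apply: filterS (accessible_full gF nil) => n + _.
move=> [n _ /(_ n (leqnn n)) Fn].
have [a [aE Fa]] := inaccessible_miss T_hausdorff gF n.+1 iw.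
have fin : \forall s \near 0^'+, forall l, f (g l 0) <> g w s.
  apply: filter_forall => l; apply/at_right0P.
  have [[s0 [s0E H]]|H] := pselect (exists s0,
    0 < s0 < 1 /\ f (g l 0) = g w s0).
    exists s0; first by lra.
    move=> s sE; rewrite H => /(arc_inj S) E.
    by have : s0 = s by [apply: E; lra]; lra.
  by exists 1 => // s sE E; apply: H; exists s.
have sa : \forall s \near 0^'+, 0 < s < a.
  by apply/at_right0P; exists a => //; lra.
apply: filterS2 fin sa => s fins sE x fx.
have nFx : ~ F n x.
  by move=> Fx; apply: (Fa s); [lra|rewrite -fx (leg_image gF); exists x].
have [l [t [tE tx]]] := arc_cover S x.
have [Fl1 Fl2] := Fn l.
have il : inaccessible l.
  by apply: contrapT => nil; apply: nFx; apply: Fl2 => //; exists t.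
exists l, t; split => //; apply/andP; split; last first.
  rewrite ltNge; apply/negP => te; apply: nFx; apply: Fl1; exists t;
    split => //.
  by lra.
rewrite lt_neqAle; apply/andP; split; last by lra.
by apply/eqP => t0; apply: (fins l); rewrite [X in g l X]t0 tx fx.
Qed.

(* If f(g v t) left the germ of w it would sweep over the end of w, which is
   impossible because the image of a compact part of a leg lies in some F n. *)
Lemma germ_invariant v w (d : R) : inaccessible w -> leads v w -> 0 < d ->
  \forall t \near 0^'+, exists s, 0 < s < d /\ f (g v t) = g w s.
Proof.
move=> iw vw d0; pose d1 := Num.min d (1 / 2).
have [d10 d1d d1h] : [/\ 0 < d1, d1 <= d & d1 <= 1 / 2].
  by rewrite /d1 lt_min !ge_min !lexx orbT d0; split => //; lra.
(* The level [d'] has to differ from the image of the end of [v], which rules out at most one value;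
   by continuity points near that end then avoid [g w d']. *)
have [d' [d'0 d'd d'1 nd']] : exists d',
  [/\ 0 < d', d' <= d, d' < 1 & f (g v 0) <> g w d'].
  have [E1|] := pselect (f (g v 0) = g w d1); last by exists d1; split => //;
    lra.
  exists (d1 / 2); split; [lra|lra|lra|rewrite E1 => /(arc_inj S) E].
  by have : d1 = d1 / 2 by [apply: E; lra]; lra.
have cl : closed [set g w d'].
  by apply: finite_closed => //; exact: finite_set1.
have [eps /= eps0 epsE] : \forall t \near (0 : R), f (g v t) <> g w d'.
  have : \forall y \near f (g v 0), y <> g w d'.
    by apply: open_nbhs_nbhs; split; [exact: closed_openC cl|].
  have cc : continuous (f \o g v).
    by move=> t; apply: continuous_comp; [exact: (arc_cont S)|exact: f_cont].
  exact: (cc 0).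
pose e1 := Num.min eps d'.
have [e10 e1e e1d] : [/\ 0 < e1, e1 <= eps & e1 <= d'].
  by rewrite /e1 lt_min !ge_min !lexx orbT d'0 eps0; split => //; lra.
have [|t' [s' [t'E s'E ts']]] := vw e1; first by lra.
apply/at_right0P; exists e1 => [|t tE]; first by lra.
pose lo := Num.min t t'; pose hi := Num.max t t'.
have [lo0 lot lot'] : [/\ 0 < lo, lo <= t & lo <= t'].
  by rewrite /lo lt_min !ge_min !lexx orbT; split => //; lra.
have [hie hit hit'] : [/\ hi < e1, t <= hi & t' <= hi].
  by rewrite /hi gt_max !le_max !lexx orbT; split => //; lra.
pose C := f @` carc (g v) lo hi.
have Cc : connected C.
  apply: connected_continuous_connected; last exact: continuous_subspaceT.
  exact: (carc_connected (@arc_cont _ _ _ _ S v)).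
have [n _ /(_ n (leqnn n)) Fn] := leg_tail gF v lo0.
have CF : C `<=` F n.+1.
  rewrite (leg_image gF) => _ [x [u [uE ux]] <-]; exists x => //.
  by apply: Fn; exists u; split => //; lra.
have [a [aE Fa]] := inaccessible_miss T_hausdorff gF n.+1 iw.
pose r := Num.min a s' / 2.
have [r0 ra rs] : [/\ 0 < r, r <= a & r < s'].
  have m0 : 0 < Num.min a s' by rewrite lt_min; lra.
  have [ma ms] : Num.min a s' <= a /\ Num.min a s' <= s' by rewrite !ge_min
    !lexx orbT.
  by rewrite /r; split; lra.
have Cg : C `<=` oarc (g w) r d'.
  apply: (@connected_gap _ _ _ _ T_hausdorff S C w r d' s') => //; try lra.
  - by move=> /CF; apply: Fa; lra.
  - move=> [x [u [uE ux]]]; rewrite -ux; apply: epsE.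
    by rewrite /= sub0r normrN gtr0_norm; lra.
  - by rewrite -ts'; exists (g v t') => //; exists t'; split => //; apply/andP;
      split.
have [|s [sE st]] := Cg (f (g v t)); first by exists (g v t) => //; exists t;
  split => //; apply/andP; split.
by exists s; split; [lra|].
Qed.

Lemma leads_fun v w w' : inaccessible w -> inaccessible w' ->
  leads v w -> leads v w' -> w = w'.
Proof.
move=> iw iw' vw vw'.
have h0 : 0 < (1 / 2 : R) by lra.
near (0 : R)^'+ => t.
have [s [sE E]] : exists s, 0 < s < 1 / 2 /\ f (g v t) = g w s.
  by near: t; exact: germ_invariant.
have [s' [sE' E']] : exists s, 0 < s < 1 / 2 /\ f (g v t) = g w' s.
  by near: t; exact: germ_invariant.
by have [|||-> _] := @arc_inner _ _ _ _ S w w' s s'; rewrite -?E -?E'//; lra.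
Unshelve. all: by end_near. Qed.

Lemma not_leads v w : ~ leads v w -> \forall eps \near 0^'+, forall t s,
  0 < t < eps -> 0 < s < eps -> f (g v t) <> g w s.
Proof.
move=> /existsNP[d /not_implyP[d0 H]]; apply/at_right0P;
  exists d => // eps epsE t s tE sE E.
by apply: H; exists t, s; split => //; lra.
Qed.

(** By surjectivity points near the end of [w] have preimages, which [germ_preimage] puts near
    inaccessible ends. As there are finitely many legs, if none led to [w] this would fail at one
    common scale. *)
Lemma leads_exists w : inaccessible w -> exists v, inaccessible v /\ leads v w.
Proof.
move=> iw; apply: contrapT => /forallNP H.
have H' : \forall eps \near 0^'+, forall v, inaccessible v -> forall t s,
    0 < t < eps -> 0 < s < eps -> f (g v t) <> g w s.
  apply: filter_forall => v; have [iv|niv] := pselect (inaccessible v);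
    last first.
    by apply/at_right0P; exists 1 => // ? _ /niv.
  have /not_leads : ~ leads v w by move=> vw; apply: (H v).
  by apply: filterS => eps + _.
have e0 : \forall eps \near (0 : R)^'+, 0 < eps by exact: nbhs_right_gt.
near (0 : R)^'+ => eps; have eps0 : 0 < eps by near: eps.
have Q := germ_preimage iw eps0; near (0 : R)^'+ => s.
have sf := mixing_surjective T_hausdorff T_compact f_cont f_mix.
have [x _ fx] : (f @` [set: T]) (g w s) by rewrite sf.
have [v [t [iv tE xt]]] : exists v t,
  [/\ inaccessible v, 0 < t < eps & x = g v t].
  by move: (x) fx; near: s.
have : forall t s, 0 < t < eps -> 0 < s < eps -> f (g v t) <> g w s.
  by move: (v) iv; near: eps.
move=> /(_ t s tE); apply; last by rewrite -xt.
by apply/andP; split; near: s; [exact: nbhs_right_gt|exact: nbhs_right_lt].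
Unshelve. all: by end_near. Qed.

Let W := {l : L | `[< inaccessible l >]}.

Let W_inaccessible (w : W) : inaccessible (val w).
Proof. exact: asboolW (valP w). Qed.

Let pred_exists (w : W) : exists v : W, leads (val v) (val w).
Proof.
have [v [/asboolP iv vw]] := leads_exists (W_inaccessible w).
by exists (Sub v iv); rewrite SubK.
Qed.

Let pre (w : W) : W := projT1 (cid (pred_exists w)).

Let preP w : leads (val (pre w)) (val w).
Proof. by rewrite /pre; case: cid. Qed.

Let pre_inj : injective pre.
Proof.
move=> w w' E; apply/val_inj/(leads_fun (W_inaccessible w) (W_inaccessible w')
  (preP w)).
by rewrite E; exact: preP.
Qed.

(** [pre] is onto, being an injection of a finite set, so [v] is the chosen predecessor of some end,
    and [v] leads to one end only. *)
Let pre_unique (v w : W) : leads (val v) (val w) -> v = pre w.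
Proof.
have /codomP[w' ->] := injF_onto pre_inj v => vw; congr pre; apply/val_inj.
exact: (leads_fun (W_inaccessible w') (W_inaccessible w) (preP w')).
Qed.

Let pre_preimage (w : W) (eps : R) : 0 < eps -> \forall s \near 0^'+,
  forall x, f x = g (val w) s -> exists t, 0 < t < eps /\ x = g (val (pre w)) t.
Proof.
move=> eps0.
have H' : \forall d \near 0^'+, forall v : W, v != pre w -> forall t s,
    0 < t < d -> 0 < s < d -> f (g (val v) t) <> g (val w) s.
  apply: filter_forall => v; have [->|nv] := eqVneq v (pre w).
    by apply/at_right0P; exists 1.
  have /not_leads : ~ leads (val v) (val w).
    by move=> /pre_unique E; move/eqP: nv.
  by apply: filterS => d + _.
have de : \forall d \near (0 : R)^'+, 0 < d < eps.
  by apply/at_right0P; exists eps.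
near (0 : R)^'+ => d.
have dE : 0 < d < eps by near: d.
have d0 : 0 < d by lra.
have Hd : forall v : W, v != pre w -> forall t s,
    0 < t < d -> 0 < s < d -> f (g (val v) t) <> g (val w) s by near: d.
have sd : \forall s \near (0 : R)^'+, 0 < s < d by apply/at_right0P; exists d.
apply: filterS2 sd (germ_preimage (W_inaccessible w) d0) => s sE H x fx.
have [v [t [iv tE xt]]] := H x fx.
exists t; split; first by lra.
have [E|/Hd H2] := eqVneq (Sub v (asboolT iv) : W) (pre w).
  by rewrite -E SubK.
by case: (H2 t s tE sE); rewrite SubK -xt.
Unshelve. all: by end_near. Qed.

Lemma iter_germ_invariant k (w : W) (d : R) : 0 < d -> \forall t \near 0^'+,
  exists s, 0 < s < d /\ iter k f (g (val (iter k pre w)) t) = g (val w) s.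
Proof.
elim: k d => [|k IH] d d0.
  by apply/at_right0P; exists d => // t tE; exists t.
have /at_right0P[d' d'0 H] := IH d d0.
apply: filterS (germ_invariant (W_inaccessible (iter k pre w)) (preP _) d'0).
by move=> t [s [sE E]]; rewrite iterSr /= E; exact: H.
Qed.

Lemma iter_germ_preimage k (w : W) (eps : R) : 0 < eps -> \forall s \near 0^'+,
  forall x, iter k f x = g (val w) s ->
    exists t, 0 < t < eps /\ x = g (val (iter k pre w)) t.
Proof.
elim: k eps => [|k IH] eps eps0.
  by apply/at_right0P; exists eps => // s sE x /= ->; exists s.
have /at_right0P[d d0 H] := pre_preimage (iter k pre w) eps0.
apply: filterS (IH d d0) => s Hs x; rewrite iterSr => /Hs[t [tE /H]].
exact.
Qed.

(** The period is the length of a cycle of the permutation [pre], hence at most the number of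
    inaccessible ends. *)
Lemma periodic_germ : exists w m, [/\ inaccessible w,
  (0 < m <= #|[pred l : L | `[< inaccessible l >]]|)%N,
  forall d : R, 0 < d -> \forall t \near 0^'+,
    exists s, 0 < s < d /\ iter m f (g w t) = g w s &
  forall eps : R, 0 < eps -> \forall s \near 0^'+, forall x,
    iter m f x = g w s -> exists t, 0 < t < eps /\ x = g w t].
Proof.
have [w0 iw0] := inaccessible_exists gF.
pose w : W := Sub w0 (asboolT iw0).
have E : iter (fingraph.order pre w) pre w = w by exact: iter_order.
exists w0, (fingraph.order pre w); split => //.
- rewrite order_gt0 /=; apply: leq_trans (max_card _) _.
  by rewrite card_sub.
- by move=> d d0; have := iter_germ_invariant (fingraph.order pre w) w d0;
    rewrite E SubK.
- by move=> eps eps0; have := iter_germ_preimage (fingraph.order pre w) w eps0;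
    rewrite E SubK.
Qed.

End Germs.

(* [h] stands for the iterate of the map under which the germ of [w] is
   periodic. *)
Section ReturnMap.
Variables (R : realType) (T : topologicalType) (L : finType) (g : L -> R -> T).
Hypotheses (T_hausdorff : hausdorff_space T) (S : arc_system g [set: T]).
Variables (h : T -> T) (w : L).
Hypothesis h_cont : continuous h.
Hypothesis h_mix : forall U V : set T, open U -> open V -> U !=set0 ->
  V !=set0 -> exists k, (iter k h @` U) `&` V !=set0.
Hypothesis h_inv : forall d : R, 0 < d -> \forall t \near 0^'+,
  exists s, 0 < s < d /\ h (g w t) = g w s.
Hypothesis h_pre : forall eps : R, 0 < eps -> \forall s \near 0^'+, forall x,
  h x = g w s -> exists t, 0 < t < eps /\ x = g w t.

(* The junk value 0 is taken where [h] leaves the leg. *)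
Definition return_map (t : R) : R :=
  xget 0 [set s | 0 < s < 1 /\ h (g w t) = g w s].

Lemma return_mapP t s : 0 < s < 1 -> h (g w t) = g w s -> return_map t = s.
Proof.
move=> sE E; rewrite /return_map; case: xgetP => [u _ [uE E']|/(_ s)[]//].
by have [|||_] := @arc_inner _ _ _ _ S w w u s; rewrite -?E -?E'//; lra.
Qed.

(** If the upward clause failed at [t], the arc [(0, t]] would be forward invariant under [h]; if
    the downward clause failed, [(0, t)] would contain all its preimages. Either contradicts mixing,
    tested against the arc [(t, 1)]. The second argument needs every preimage to lie on the leg
    below [d], which is why [s] is taken from [h_pre] at scale [D / 2]. *)
Lemma return_map_germ : exists s d D : R, [/\ [/\ 0 < s, s < d, d < D & D <= 1],
  forall t, 0 < t < D -> 0 < return_map t < 1 /\ h (g w t) = g w (return_map t),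
  forall t, 0 < t < D -> {for t, continuous return_map},
  forall t, 0 < t < s -> exists x, 0 < x <= t /\ t < return_map x &
  forall t, 0 < t < s -> exists y, t <= y < d /\ return_map y < t].
Proof.
have /at_right0P[D0 D00 D0E] := h_inv ltr01.
pose D := Num.min D0 1.
have [DD0 D1] : D <= D0 /\ D <= 1 by rewrite /D !ge_min !lexx orbT.
have Dgt0 : 0 < D by rewrite /D lt_min D00 ltr01.
have rP t : 0 < t < D -> 0 < return_map t < 1 /\ h (g w t) = g w (return_map t).
  by move=> tE; have [|s [sE E]] := D0E t; [lra|rewrite (return_mapP sE E)].
have d0 : 0 < D / 2 by lra.
have /at_right0P[s0 s00 s0E] := h_pre d0.
pose s := Num.min s0 (D / 4).
have [ss0 sd] : s <= s0 /\ s <= D / 4 by rewrite /s !ge_min !lexx orbT.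
have sgt0 : 0 < s by rewrite /s lt_min s00; lra.
have go (a b : R) : 0 <= a -> b <= 1 -> open (oarc (g w) a b).
  by move=> *; exact: (oarc_open T_hausdorff S).
have mix a b c d' : 0 <= a -> a < b -> b <= 1 -> 0 <= c -> c < d' -> d' <= 1 ->
    exists k, (iter k h @` oarc (g w) a b) `&` oarc (g w) c d' !=set0.
  by move=> *; apply: h_mix; first [exact: go | exact: oarc_neq0].
have ginj u v : 0 < u < 1 -> 0 <= v <= 1 -> g w u = g w v -> u = v.
  by move=> uE vE E; have [] := @arc_inner _ _ _ _ S w w u v uE vE E.
exists s, (D / 2), D; split => //; first by split; lra.
- move=> t tE; have [rE hE] := rP t tE; apply/cvgrPdist_lt => eps eps0.
  pose lo := Num.max 0 (return_map t - eps).
  pose hi := Num.min 1 (return_map t + eps).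
  have [lo0 loE lor] : [/\ 0 <= lo,
    return_map t - eps <= lo & lo < return_map t].
    by rewrite /lo gt_max !le_max !lexx orbT; split => //; lra.
  have [hi1 hiE hir] : [/\ hi <= 1,
    hi <= return_map t + eps & return_map t < hi].
    by rewrite /hi lt_min !ge_min !lexx orbT; split => //; lra.
  have cc : continuous (h \o g w).
    by move=> u; apply: continuous_comp; [exact: (arc_cont S)|exact: h_cont].
  have N1 : \forall u \near t, oarc (g w) lo hi (h (g w u)).
    apply: (cc t); apply: open_nbhs_nbhs; split; first exact: go.
    by rewrite /= hE; exists (return_map t); split => //; lra.
  have N2 : \forall u \near t, 0 < u < D.
    have m0 : 0 < Num.min t (D - t) by rewrite lt_min; lra.
    have [mt mD] : Num.min t (D - t) <= t /\ Num.min t (D - t) <= D - t.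
      by rewrite !ge_min !lexx orbT.
    by exists (Num.min t (D - t)) => // u; rewrite /= ltr_norml; lra.
  apply: filterS2 N1 N2 => u [v [vE vu]] uE.
  have [ruE huE] := rP u uE; have E : return_map u = v.
    by apply: ginj => //; [lra|rewrite vu huE].
  by rewrite E ltr_norml; lra.
- move=> t tE; apply: contrapT => /forallNP H.
  have inv k y : 0 < y <= t -> exists z, 0 < z <= t /\ iter k h (g w y) = g w z.
    elim: k y => [|k IH] y yE; first by exists y.
    have [rE hE] : 0 < return_map y < 1 /\ h (g w y) = g w (return_map y) by
      apply: rP; lra.
    rewrite iterSr hE; apply: IH.
    rewrite leNgt; apply/andP; split; first by lra.
    by apply/negP => rt; apply: (H y).
  have [||||||k [_ [[_ [y [yE <-]] <-] [u [uE E]]]]] := mix 0 t t 1; try lra.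
  have [|z [zE E']] := inv k y; first by lra.
  by have : u = z by [apply: ginj; [lra|lra|rewrite E E']]; lra.
move=> t tE; apply: contrapT => /forallNP H.
have inv k x : oarc (g w) 0 t (iter k h x) -> oarc (g w) 0 t x.
  elim: k x => [//|k IH] x; rewrite iterSr => /IH[u [uE E]].
  have [|y [yE xy]] := s0E u _ x (esym E); first by lra.
  exists y; split => //; rewrite ltNge; apply/andP; split; first by lra.
  apply/negP => ty; apply: (H y); split; first by lra.
  by rewrite (@return_mapP y u) -?xy//; lra.
have [||||||k [_ [[x [y [yE yx]] <-] /inv[u [uE E]]]]] := mix t 1 0 t; try lra.
by have : u = y by [apply: ginj; [lra|lra|rewrite E yx]]; lra.
Qed.

End ReturnMap.

(** * Disconnecting numbers *)

Lemma big_fiber (n b : nat) (C : finType) (c : 'I_n -> C) : (b * #|C| < n)%N ->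
  exists y, (b < #|[pred j | c j == y]|)%N.
Proof.
move=> nb; apply: contrapT => /forallNP H; move: nb; rewrite ltnNge => /negP;
  apply.
rewrite -[leqLHS]card_ord -sum1_card (partition_big c xpredT)//=.
rewrite mulnC -sum_nat_const; apply: leq_sum => y _.
by rewrite sum1_card leqNgt; apply/negP/H.
Qed.

Section DisconnectingBound.
Variables (R : realType) (T : topologicalType) (I : finType) (e : I -> R -> T).
Hypotheses (T_hausdorff : hausdorff_space T) (eS : arc_system e [set: T]).
Variables (H D : set T).
Hypotheses (H_conn : connected H) (DH : D `<=` H) (D_fin : finite_set D).
Hypothesis HD_conn : connected (H `\` D).

Let closed_fin (A : set T) : finite_set A -> closed A.
Proof. exact: finite_closed. Qed.

(** With both gaps empty and [D] finite, [e i q] is isolated in the connected set [H], which also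
    contains [e i p]. *)
Let adjacent_gaps i (p q r : R) : 0 < p -> p < q -> q < r -> r < 1 ->
  D (e i p) -> D (e i q) -> (H `\` D) `&` oarc (e i) p q = set0 ->
  (H `\` D) `&` oarc (e i) q r = set0 -> False.
Proof.
move=> p0 pq qr r1 Dp Dq Cpq Cqr.
have E : [set e i q] = H.
  apply: H_conn; first by exists (e i q).
  - exists (oarc (e i) p r `&` ~` (D `\ e i q)).
      apply: openI; first by apply: (oarc_open T_hausdorff eS); lra.
      by apply: closed_openC; apply: closed_fin; exact: finite_setD.
    apply/seteqP; split => [x ->|x [Hx [[t [tE tx]] nDx]]].
      split; first exact: DH.
      by split; [exists q; split => //; lra|move=> [_]; exact].
    apply: contrapT => xq; have nD : ~ D x by move=> Dx; apply: nDx; split.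
    have [tq|qt|tq] := ltgtP t q.
    + suff : ((H `\` D) `&` oarc (e i) p q) x by rewrite Cpq.
      by split => //; exists t; split => //; lra.
    + suff : ((H `\` D) `&` oarc (e i) q r) x by rewrite Cqr.
      by split => //; exists t; split => //; lra.
    + by apply: xq; rewrite -tx tq.
  - exists [set e i q]; first by apply: closed_fin; exact: finite_set1.
    by apply/seteqP; split => [x -> |x []//]; split => //; exact: DH.
have : [set e i q] (e i p) by rewrite E; exact: DH.
move=> /(arc_inj eS) Epq; have : p = q by apply: Epq; lra.
by lra.
Qed.

(** A gap between two points of [D] misses the connected set H minus D or contains all of it. Hence
    at most one of the four gaps meets it, and two adjacent gaps are empty. *)
Let five_points i (p1 p2 p3 p4 p5 : R) : 0 < p1 -> p1 < p2 -> p2 < p3 ->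
  p3 < p4 -> p4 < p5 -> p5 < 1 -> D (e i p1) -> D (e i p2) -> D (e i p3) ->
  D (e i p4) -> D (e i p5) -> False.
Proof.
move=> p0 p12 p23 p34 p45 p51 D1 D2 D3 D4 D5.
have gap p q : 0 < p -> p < q -> q < 1 -> D (e i p) -> D (e i q) ->
    (H `\` D) `&` oarc (e i) p q = set0 \/ H `\` D `<=` oarc (e i) p q.
  move=> p00 pq q1 Dp Dq; have [E|/set0P] :=
    eqVneq ((H `\` D) `&` oarc (e i) p q) set0.
    by left.
  move=> [x [Cx [t [tE tx]]]]; right.
  apply: (@connected_gap _ _ _ _ T_hausdorff eS _ i p q t) => //; try lra.
  - by move=> -[].
  - by move=> -[].
  - by rewrite tx.
have far p q p' q' : H `\` D `<=` oarc (e i) p q -> 0 < p -> q <= p' ->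
  q' < 1 ->
    (H `\` D) `&` oarc (e i) p' q' = set0.
  move=> Cpq p00 qp q1; apply/seteqP; split => // x [Cx [t [tE tx]]].
  have [u [uE ux]] := Cpq x Cx; have [|||_ E] := @arc_inner _ _ _ _ eS i i u t.
  - by lra.
  - by lra.
  - by rewrite ux tx.
  by have : u < u by [lra]; rewrite ltxx.
have G12 : (H `\` D) `&` oarc (e i) p1 p2 = set0 \/ H `\` D `<=` oarc (e i) p1
  p2.
  by apply: gap => //; lra.
have G23 : (H `\` D) `&` oarc (e i) p2 p3 = set0 \/ H `\` D `<=` oarc (e i) p2
  p3.
  by apply: gap => //; lra.
case: G12 => g1; last first.
  apply: (@adjacent_gaps i p3 p4 p5) => //; first by lra.
    by apply: (far p1 p2) => //; lra.
  by apply: (far p1 p2) => //; lra.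
case: G23 => g2; first by apply: (@adjacent_gaps i p1 p2 p3) => //; lra.
apply: (@adjacent_gaps i p3 p4 p5) => //; first by lra.
  by apply: (far p2 p3) => //; lra.
by apply: (far p2 p3) => //; lra.
Qed.

(** The points of [D] are coloured by the arc end or the arc interior on which they lie. An end
    colour is used at most once, an interior colour at most four times. *)
Lemma nondisconnecting_card n : (D #= `I_n)%card ->
  (n <= 4 * #|{: (I * bool) + I}|)%N.
Proof.
move=> /card_set_bijP[h' [_ _ h_surj]]; rewrite leqNgt; apply/negP => big.
have surj (j : 'I_n) : exists2 x, D x & h' x = j by exact: h_surj (ltn_ord j).
pose h j := projT1 (cid2 (surj j)).
have hD j : D (h j) by rewrite /h; case: cid2.
have hK j : h' (h j) = j by rewrite /h; case: cid2.
pose ix x := projT1 (cid (arc_cover eS x)).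
have ixP x : exists t, 0 <= t <= 1 /\ e (ix x) t = x by rewrite /ix; case: cid.
pose tx x := projT1 (cid (ixP x)).
have txP x : 0 <= tx x <= 1 /\ e (ix x) (tx x) = x by rewrite /tx; case: cid.
pose c (j : 'I_n) : (I * bool) + I := let x := h j in
  if tx x == 0 then inl (ix x, false) else
  if tx x == 1 then inl (ix x, true) else inr (ix x).
have hinj (j k : 'I_n) : h j = h k -> j = k.
  by move=> E; apply/val_inj => /=; rewrite -(hK j) -(hK k) E.
have xE (j k : 'I_n) : ix (h j) = ix (h k) -> tx (h j) = tx (h k) -> j = k.
  move=> E1 E2; apply: hinj; rewrite -(proj2 (txP (h j))) -(proj2 (txP (h k))).
  by rewrite E1 E2.
have [[[i b]|i] fib] := big_fiber c big.
  have /card_gt1P[j [k [jE kE jk]]] := leq_trans (isT : (1 < 5)%N) fib.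
  have ends l : c l == inl (i, b) -> ix (h l) = i /\ tx (h l) = b%:R.
    rewrite /c; case: (eqVneq (tx (h l)) 0) => [-> /eqP[-> <-]//|_].
    by case: (eqVneq (tx (h l)) 1) => [-> /eqP[-> <-]|_ /eqP].
  move: jE kE; rewrite !inE => /ends[ji jb] /ends[ki kb].
  by move/eqP: jk; apply; apply: xE; rewrite ?ji ?ki ?jb ?kb.
pose fi := [pred j | c j == inr i].
have fiP j : j \in fi -> ix (h j) = i /\ 0 < tx (h j) < 1.
  rewrite inE /c; have [tE _] := txP (h j).
  case: (eqVneq (tx (h j)) 0) => // j0;
    case: (eqVneq (tx (h j)) 1) => // j1 /eqP[ji].
  by split => //; rewrite !lt_neqAle eq_sym j0 j1.
pose s := sort <=%R [seq tx (h j) | j <- enum fi].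
have sP t : t \in s -> 0 < t < 1 /\ D (e i t).
  rewrite mem_sort => /mapP[j]; rewrite mem_enum => /fiP[ji jt] ->; split => //.
  by rewrite -ji (proj2 (txP (h j))); exact: hD.
have ss : sorted <%R s.
  rewrite sort_lt_sorted map_inj_in_uniq ?enum_uniq// => j k.
  by rewrite !mem_enum => /fiP[ji _] /fiP[ki _] E; apply: xE => //;
    rewrite ji ki.
have sz : (4 < size s)%N by rewrite size_sort size_map -cardE.
move: ss sz sP; case: s => [|p1 [|p2 [|p3 [|p4 [|p5 s']]]]] //=.
move=> /and5P[p12 p23 p34 p45 _] _ sP.
have [|q1 D1] := sP p1; first by rewrite inE eqxx.
have [|q2 D2] := sP p2; first by rewrite !inE eqxx ?orbT.
have [|q3 D3] := sP p3; first by rewrite !inE eqxx ?orbT.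
have [|q4 D4] := sP p4; first by rewrite !inE eqxx ?orbT.
have [|q5 D5] := sP p5; first by rewrite !inE eqxx ?orbT.
by apply: (@five_points i p1 p2 p3 p4 p5) => //; lra.
Qed.

End DisconnectingBound.

(** * Existence of the maximal disconnecting number *)

Section LambdaBound.
Variables (R : realType) (T : metricType R) (I : finType) (e : I -> R -> T).
Hypothesis eS : arc_system e [set: T].

Let bound := (4 * #|{: (I * bool) + I}|).+1.

Let bound_disconnecting (H : set T) : connected H -> disconnecting H bound.
Proof.
move=> Hc D DH Dn HDc; have : (bound <= 4 * #|{: (I * bool) + I}|)%N.
  apply: (@nondisconnecting_card _ _ _ _ (@metric_hausdorff _ T) eS H D) => //.
  by apply/finite_setP; exists bound.
by rewrite ltnn.
Qed.

Lemma disconnecting_number_le (H : set T) : connected H ->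
  (disconnecting_number H <= bound)%N.
Proof.
move=> Hc; rewrite /disconnecting_number; case: xgetP => [n _ [_ _ le]|//].
by apply: le => //; exact: bound_disconnecting.
Qed.

Lemma disconnecting_number_gt (H : set T) w : connected H ->
  (forall k, (0 < k <= w)%N -> exists D : set T,
     [/\ D `<=` H, (D #= `I_k)%card & connected (H `\` D)]) ->
  (w < disconnecting_number H)%N.
Proof.
move=> Hc Hw; pose P k := (0 < k)%N && `[< disconnecting H k >].
have exP : exists k, P k.
  by exists bound; rewrite /P /=; apply/asboolP; exact: bound_disconnecting.
have [n nP nmin] := ex_minnP exP; move: nP => /andP[n0 /asboolP nD].
rewrite /disconnecting_number; case: xgetP => [k _ [k0 kD _]|/(_ n)].
  rewrite ltnNge; apply/negP => kw; have [|D [DH Dk HDc]] := Hw k;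
    first by rewrite k0.
  exact: (kD D DH Dk).
case; split => // k k0 kD; apply: nmin; rewrite /P k0; exact/asboolP.
Qed.

(** All sizes [k] up to [w] are tested because the disconnecting number is a least one. The uniform
    bound makes the minimum and the maximum exist, so neither default value 0 is taken. *)
Lemma Lambda_gt (H : set T) w : is_graph H ->
  (forall k, (0 < k <= w)%N -> exists D : set T,
     [/\ D `<=` H, (D #= `I_k)%card & connected (H `\` D)]) ->
  (w < Lambda T)%N.
Proof.
move=> Hg Hw; have [_ Hc _] := Hg.
apply: leq_trans (disconnecting_number_gt Hc Hw) _.
pose P n := `[< exists2 H : set T, is_graph H & disconnecting_number H = n >].
have exP : exists n, P n by exists (disconnecting_number H); apply/asboolP;
  exists H.
have ubP n : P n -> (n <= bound)%N.
  by move=> /asboolP[K [_ Kc _] <-]; exact: disconnecting_number_le.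
have [n nP nmax] := ex_maxnP exP ubP.
rewrite /Lambda; case: xgetP => [k _ [_ kmax]|/(_ n)]; first exact: kmax.
case; split; first exact/asboolP.
by move=> K Kg; apply: nmax; apply/asboolP; exists K.
Qed.

End LambdaBound.

(** * Arc systems and simplicial complexes *)

Lemma matrix_continuous (R : realType) m n (x : R -> 'M[R]_(m, n)) :
  (forall i j, continuous (fun t => x t i j)) -> continuous x.
Proof.
move=> xc t A [P Pn PA].
have H : \forall u \near t, forall i j, P i j (x u i j).
  apply: (@filter_forall _ _ (fun i u => forall j, P i j (x u i j)) (nbhs t)) =>
    i.
  apply: (@filter_forall _ _ (fun j u => P i j (x u i j)) (nbhs t)) => j.
  by apply: (xc i j t); exact: Pn.
by apply: (@filterS _ (nbhs t) _ _ _ _ H) => u Pu; exact: PA.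
Qed.

Lemma within_continuous_curve (R : realType) (X Y : topologicalType) (B : set X)
    (k : X -> Y) (x : R -> X) : {within B, continuous k} -> continuous x ->
  (forall t, B (x t)) -> continuous (k \o x).
Proof.
move=> kc xc xB; apply/continuousP => V Vo.
have /continuousP/(_ V Vo)/open_subspaceP[U Uo UV] := kc.
rewrite (_ : _ @^-1` V = x @^-1` U); first by move/continuousP: xc; exact.
apply/seteqP; split => t /= tV.
  have : (U `&` B) (x t) by rewrite UV; split => //; exact: xB.
  by case.
have : ((k : subspace B -> Y) @^-1` V `&` B) (x t) by rewrite -UV; split => //;
  exact: xB.
by case.
Qed.

(** Pasting along finitely many arcs: the preimage of a closed set is, within [A], a finite union of
    images of compact parameter sets. *)
Lemma continuous_along_arcs (R : realType) (X Y : topologicalType) (I : finType)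
    (a : I -> R -> X) (b : I -> R -> Y) (A : set X) (k : X -> Y) :
  hausdorff_space X -> (forall i, continuous (a i)) ->
    (forall i, continuous (b i)) ->
  (forall x, A x -> exists i t, 0 <= t <= 1 /\ a i t = x) ->
  (forall i t, 0 <= t <= 1 -> k (a i t) = b i t) ->
  {within A, continuous k}.
Proof.
move=> Xh ac bc Aa kab; apply/continuous_closedP => Z Zc;
  apply/closed_subspaceP.
pose V i := a i @` (`[0, 1] `&` b i @^-1` Z).
exists (\bigcup_(i in [set: I]) V i).
  apply: closed_bigcup => [|i _]; first exact: finite_finset.
  apply: compact_closed => //; apply: continuous_compact.
    exact/continuous_subspaceT/ac.
  apply: compact_closedI; first exact: segment_compact.
  by move/continuous_closedP: (bc i); exact.
apply/seteqP; split => x [Vx Ax]; split => //.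
  case: Vx => i _ [t [/= /in_itvcc tE Zt] tx].
  by suff : Z (k x) by []; rewrite -tx kab.
have [i [t [tE tx]]] := Aa x Ax; exists i => //; exists t => //.
split; first by rewrite /= in_itv.
by rewrite /preimage /= -kab // tx.
Qed.

(** * Triangulation of a set covered by an arc system *)

Section SubdividedGraph.
Variables (R : realType) (T : metricType R) (I : finType) (e : I -> R -> T).
Variable A : set T.
Hypothesis eA : arc_system e A.

(* Vertices: one per class of arc ends (represented by a chosen end of some
   arc), plus the midpoint of every arc, so that no two edges of the complex
   have the same ends. *)
Let V := ((I * bool) + I)%type.

Let end_pt (p : I * bool) : T := e p.1 (p.2%:R).

Let rep (p : I * bool) : I * bool :=
  odflt p [pick q | `[< end_pt q = end_pt p >]].

Let rep_pt p : end_pt (rep p) = end_pt p.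
Proof. by rewrite /rep; case: pickP => [q /asboolP//|_]. Qed.

Let rep_eq p q : end_pt p = end_pt q -> rep p = rep q.
Proof.
move=> E; rewrite /rep (@eq_pick _ _ [pred r | `[< end_pt r = end_pt q >]]);
  last first.
  by move=> r /=; rewrite E.
by case: pickP => //= /(_ q) /asboolP.
Qed.

Let ends_neq i : rep (i, false) != rep (i, true).
Proof.
apply/eqP => E; have : end_pt (i, false) = end_pt (i,
  true) by rewrite -rep_pt E rep_pt.
have [_ H _ _] := eA; rewrite /end_pt /= => /H E'.
by have : (0 : R) = 1 by [apply: E'; lra]; lra.
Qed.

(** Barycentric weights of the two ends along the path from one end through the midpoint vertex to
    the other; the midpoint gets the remaining weight. *)
Let wt0 (s : R) : R := Num.max 0 (1 - 2 * s).
Let wt1 (s : R) : R := Num.max 0 (2 * s - 1).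

Let wtE (s : R) : (s <= 1 / 2 /\ wt0 s = 1 - 2 * s /\ wt1 s = 0) \/
                  (1 / 2 <= s /\ wt0 s = 0 /\ wt1 s = 2 * s - 1).
Proof.
rewrite /wt0 /wt1; have [h|h] := lerP s (1 / 2); [left|right]; split; try lra.
  by rewrite max_r ?max_l; lra.
by rewrite max_l ?max_r; lra.
Qed.

Let coord i (s : R) (v : V) : R := wt0 s * (v == inl (rep (i, false)))%:R +
  wt1 s * (v == inl (rep (i, true)))%:R + (1 - wt0 s - wt1 s) * (v == inr i)%:R.

Let n := #|{: V}|.

Let path i (s : R) : 'rV[R]_n := \row_j coord i s (enum_val j).

Let pathE i s v : path i s ord0 (enum_rank v) = coord i s v.
Proof. by rewrite mxE enum_rankK. Qed.

Let path_continuous i : continuous (path i).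
Proof.
have w0 : continuous wt0.
  move=> s; apply: (@continuous_max R R^o (cst 0) (fun s => 1 - 2 * s)).
    exact: cvg_cst.
  by apply: cvgB; [exact: cvg_cst|apply: cvgM; [exact: cvg_cst|exact: cvg_id]].
have w1 : continuous wt1.
  move=> s; apply: (@continuous_max R R^o (cst 0) (fun s => 2 * s - 1)).
    exact: cvg_cst.
  by apply: cvgB; [apply: cvgM; [exact: cvg_cst|exact: cvg_id]|exact: cvg_cst].
apply: matrix_continuous => k j s.
rewrite (_ : (fun t => path i t k j) = fun t => coord i t (enum_val j));
  last first.
  by apply/funext => t; rewrite mxE.
rewrite /coord; apply: cvgD; first apply: cvgD.
- by apply: cvgM; [exact: w0|exact: cvg_cst].
- by apply: cvgM; [exact: w1|exact: cvg_cst].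
apply: cvgM; last exact: cvg_cst.
by apply: cvgB; [apply: cvgB; [exact: cvg_cst|exact: w0]|exact: w1].
Qed.

Let edge_set (p : I * bool) : {set 'I_n} :=
  finset (fun j => (j == enum_rank (inl (rep p) : V)) ||
    (j == enum_rank (inr p.1 : V))).

Let K : {set {set 'I_n}} :=
  finset (fun s => (s != finset.set0) && [exists p, s \subset edge_set p]).

Let K_complex : simplicial_complex K.
Proof.
split; first by rewrite inE eqxx.
move=> s t; rewrite !inE => /andP[_ /existsP[p sp]] t0 ts; rewrite t0.
by apply/existsP; exists p; exact: fintype.subset_trans ts sp.
Qed.

Let edge_card p : #|edge_set p| = 2%N.
Proof.
rewrite (_ : edge_set p = finset.setU
  (finset.set1 (enum_rank (inl (rep p) : V)))
    (finset.set1 (enum_rank (inr p.1 : V)))).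
  by rewrite cards2 (inj_eq enum_rank_inj).
by apply/setP => j; rewrite !inE.
Qed.

Let edge_in p : edge_set p \in K.
Proof.
rewrite inE -card_gt0 edge_card /=; apply/existsP; exists p; exact: subxx.
Qed.

Let K_dim : (exists i : I, True) -> one_dimensional K.
Proof.
move=> [i _]; split.
  by move=> s; rewrite inE => /andP[_ /existsP[p /subset_leq_card]];
    rewrite edge_card.
by exists (edge_set (i, false)); rewrite edge_in edge_card.
Qed.

Let sum_coord i s : \sum_v coord i s v = 1.
Proof.
rewrite /coord !big_split /= -!mulr_sumr.
have E (u : V) : \sum_v (v == u)%:R = 1 :> R.
  by rewrite (bigD1 u)//= eqxx big1 ?addr0// => v /negbTE ->.
by rewrite !E; ring.
Qed.

Let path_carrier i s : 0 <= s <= 1 -> carrier K (path i s).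
Proof.
move=> sE; exists (edge_set (i, ~~ (s <= 1 / 2))); first exact: edge_in.
have hs := wtE s; split.
- move=> j; rewrite mxE /coord.
  have b01 (b : bool) : 0 <= b%:R :> R by [].
  by case: hs => -[? [-> ->]]; rewrite !addr_ge0 ?mulr_ge0//; lra.
- rewrite -(sum_coord i s) (reindex (@enum_val _ _ : 'I_n -> V)) /=; last first.
    by apply: onW_bij; exact: enum_val_bij.
  by apply: eq_bigr => j _; rewrite mxE.
move=> j; rewrite inE negb_or => /andP[j1 j2]; rewrite mxE /coord.
have nj v : j != enum_rank v -> (enum_val j == v) = false.
  by move=> jv; apply/negbTE; apply: contraNneq jv => <-; rewrite enum_valK.
rewrite (nj _ j2) mulr0 addr0.
have [s2|s2] := lerP s (1 / 2).
  rewrite s2 /= in j1; rewrite (nj _ j1) mulr0 add0r.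
  by case: hs => -[? [_ ->]]; rewrite ?mul0r // (_ : 2 * s - 1 = 0) ?mul0r//;
    lra.
rewrite leNgt s2 /= in j1; rewrite (nj _ j1) mulr0 addr0.
by case: hs => -[? [-> _]]; rewrite ?mul0r //; lra.
Qed.

Let carrier_path y : carrier K y -> exists i s, 0 <= s <= 1 /\ path i s = y.
Proof.
move=> [t /=]; rewrite inE => /andP[_ /existsP[[i b] tp]] [y0 y1 yt].
have ye v : v != inl (rep (i, b)) -> v != inr i -> y ord0 (enum_rank v) = 0.
  move=> v1 v2; apply: yt; apply/negP => /(fintype.subsetP tp).
  by rewrite inE !(inj_eq enum_rank_inj) (negbTE v1) (negbTE v2).
pose u := y ord0 (enum_rank (inr i : V)).
have yE : y ord0 (enum_rank (inl (rep (i, b)) : V)) = 1 - u.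
  rewrite -y1 (reindex (@enum_rank V)) /=; last by apply: onW_bij;
    exact: enum_rank_bij.
  rewrite (bigD1 (inl (rep (i, b))))//= (bigD1 (inr i))//= big1 ?addr0.
    by rewrite /u; ring.
  by move=> v /andP[v1 v2]; exact: ye.
have u0 : 0 <= u by exact: y0.
have u1 : 0 <= 1 - u by rewrite -yE; exact: y0.
(* [u] is the weight of the midpoint vertex, which grows from 0 to 1 over half the parameter
   interval, measured from the end [b]. *)
exists i, (if b then 1 - u / 2 else u / 2); split.
  by case: (b); lra.
apply/rowP => j; rewrite -(enum_valK j); set v := enum_val j.
have [W0 W1] : wt0 (if b then 1 - u / 2 else u / 2) = (if b then 0 else 1 - u)
  /\
    wt1 (if b then 1 - u / 2 else u / 2) = (if b then 1 - u else 0).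
  have := wtE (if b then 1 - u / 2 else u / 2).
  by case: (b) => -[[? [-> ->]]|[? [-> ->]]]; split; lra.
rewrite pathE /coord W0 W1.
have [->|v2] := eqVneq v (inr i).
  by rewrite /= !mulr0 !add0r mulr1; case: (b); rewrite /u; lra.
rewrite mulr0 addr0; have en := ends_neq i.
have [->|v1] := eqVneq v (inl (rep (i, b))).
  rewrite yE; case: (b) en => en.
    by rewrite mul0r add0r eqxx mulr1.
  by rewrite mul0r addr0 eqxx mulr1.
rewrite ye //; case: (b) v1 => v1.
  by rewrite (negbTE v1) mulr0 mul0r addr0.
by rewrite (negbTE v1) mulr0 mul0r addr0.
Qed.

Hypotheses (A_compact : compact A) (A_conn : connected A) (A0 : A !=set0).

Let end_param (u : R) : 0 <= u <= 1 -> ~~ (0 < u < 1) ->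
  exists b : bool, u = b%:R.
Proof.
move=> uE; rewrite negb_and -!leNgt => /orP[u0|u1].
  by exists false; rewrite /=; lra.
by exists true; rewrite /=; lra.
Qed.

Let coord_end i (b : bool) w : coord i b%:R w = (w == inl (rep (i, b)))%:R.
Proof.
have E : wt0 b%:R = (~~ b)%:R /\ wt1 b%:R = b%:R.
  by have := wtE b%:R; case: b => /= -[[? [-> ->]]|[? [-> ->]]]; split; lra.
rewrite /coord (proj1 E) (proj2 E); case: b {E} => /=; ring.
Qed.

Let path_wd i j (s t : R) : 0 <= s <= 1 -> 0 <= t <= 1 -> e i s = e j t ->
  path i s = path j t.
Proof.
move=> sE tE E; have [_ inj inner _] := eA.
have [s01|ns] := boolP (0 < s < 1).
  have ij := inner _ _ _ _ s01 tE E; subst j; by rewrite (inj _ _ _ sE tE E).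
have [t01|nt] := boolP (0 < t < 1).
  have ij := inner _ _ _ _ t01 sE (esym E); subst j;
    by rewrite (inj _ _ _ sE tE E).
have [b bE] := end_param sE ns; have [b' bE'] := end_param tE nt.
apply/rowP => k; rewrite -(enum_valK k) !pathE bE bE' !coord_end.
by rewrite (@rep_eq (i, b) (j, b')) // /end_pt /= -bE -bE'.
Qed.

(** For an inner parameter the positive weight on the midpoint vertex identifies the arc and the
    weights of its ends identify the parameter; at an end, the vertex chosen by [rep] identifies the
    point. *)
Let path_inj i j (s t : R) : 0 <= s <= 1 -> 0 <= t <= 1 ->
  path i s = path j t ->
  e i s = e j t.
Proof.
have inner k l (u v : R) : 0 < u < 1 -> 0 <= v <= 1 -> path k u = path l v ->
    k = l /\ u = v.
  move=> uE vE E; have Ev w : coord k u w = coord l v w by rewrite -!pathE E.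
  have nz : 0 < 1 - wt0 u - wt1 u.
    by have [[? [-> ->]]|[? [-> ->]]] := wtE u; lra.
  have kl : k = l.
    have := Ev (inr k); rewrite /coord /= eqxx !mulr0 !add0r mulr1.
    have [//|kl] := eqVneq k l.
    rewrite (_ : (inr k == inr l :> V) = false); last exact/negbTE.
    by rewrite mulr0 => E0; move: nz; rewrite E0 ltxx.
  subst l; split => //.
  have en : (inl (rep (k, false)) == inl (rep (k, true)) :> V) = false.
    exact/negbTE/ends_neq.
  have en' : (inl (rep (k, true)) == inl (rep (k, false)) :> V) = false.
    by rewrite eq_sym.
  have := Ev (inl (rep (k, false))); have := Ev (inl (rep (k, true))).
  rewrite /coord en en' !eqxx /= !mulr0 !addr0 !add0r !mulr1.
  have := wtE u; have := wtE v.
  by move=> [[? [-> ->]]|[? [-> ->]]] [[? [-> ->]]|[? [-> ->]]]; lra.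
move=> sE tE E; have [s01|ns] := boolP (0 < s < 1).
  by have [<- <-] := inner _ _ _ _ s01 tE E.
have [t01|nt] := boolP (0 < t < 1).
  by have [<- <-] := inner _ _ _ _ t01 sE (esym E).
have [b bE] := end_param sE ns; have [b' bE'] := end_param tE nt.
have : coord i s (inl (rep (i, b))) = coord j t (inl (rep (i, b))).
  by rewrite -!pathE E.
rewrite bE bE' !coord_end eqxx; case: eqVneq => [[E'] _|_ /eqP];
  last by rewrite oner_eq0.
by have := rep_pt (i, b); rewrite E' rep_pt /end_pt /=.
Qed.

(** The paths in the complex make exactly the identifications made by the curves [e i], so matching
    parameters gives mutually inverse maps, both continuous by pasting. *)
Lemma arc_system_is_graph : is_graph A.
Proof.
split => //; have [ec _ _ ecov] := eA.
exists n, K; split => //.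
  by apply: K_dim; have [x /ecov[i _]] := A0; exists i.
have pick_arc x : exists p : I * R, A x -> 0 <= p.2 <= 1 /\ e p.1 p.2 = x.
  have [/ecov[i [t H]]|nA] := pselect (A x); first by exists (i, t).
  have [y /ecov[i _]] := A0; by exists (i, 0) => /nA.
pose th x := let p := projT1 (cid (pick_arc x)) in path p.1 p.2.
have thE i t : 0 <= t <= 1 -> th (e i t) = path i t.
  move=> tE; rewrite /th; case: cid => p /= H.
  have [pE E] : 0 <= p.2 <= 1 /\ e p.1 p.2 = e i t by apply: H; apply/ecov;
    exists i, t.
  exact: path_wd.
have pick_path y : exists x, carrier K y -> A x /\ th x = y.
  have [/carrier_path[i [s [sE <-]]]|nC] := pselect (carrier K y).
    by exists (e i s) => _; rewrite thE //; split => //; apply/ecov;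
      exists i, s.
  by have [x _] := A0; exists x => /nC.
pose ph y := projT1 (cid (pick_path y)).
have phP y : carrier K y -> A (ph y) /\ th (ph y) = y by rewrite /ph; case: cid.
have th_carrier x : A x -> carrier K (th x).
  by move=> /ecov[i [t [tE <-]]]; rewrite thE //; exact: path_carrier.
have phK x : A x -> ph (th x) = x.
  move=> Ax; have [Ap tp] := phP _ (th_carrier x Ax).
  have [i [t [tE tx]]] := (ecov x).1 Ax; have [j [s [sE sp]]] := (ecov _).1 Ap.
  rewrite -sp -tx; apply: path_inj => //.
  by rewrite -thE // -thE // sp tp tx.
exists th, ph; split.
- apply: (continuous_along_arcs (a := e) (b := path)) => //.
    exact: metric_hausdorff.
  by move=> x /ecov.
- apply: (continuous_along_arcs (a := path) (b := e)) => //.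
  by move=> i t tE; rewrite -thE// phK//; apply/ecov; exists i, t.
- by move=> x Ax; split; [exact: th_carrier|exact: phK].
- by move=> y yK; have [? ?] := phP y yK.
Qed.

End SubdividedGraph.

(** * The arc system of a graph *)

Section GraphArcs.
Variables (R : realType) (G : metricType R).
Hypothesis hG : is_graph [set: G].

(** The homeomorphism from the carrier is continuous only within the carrier, so a curve on the
    whole line has to stay there. *)
Definition clamp01 (t : R) : R := Num.max 0 (Num.min 1 t).

Lemma clamp01_range t : 0 <= clamp01 t <= 1.
Proof. by rewrite /clamp01 le_max lexx /= ge_max ler01 ge_min lexx. Qed.

Lemma clamp01_id t : 0 <= t <= 1 -> clamp01 t = t.
Proof. by move=> tE; rewrite /clamp01 min_r ?max_r; lra. Qed.

Lemma clamp01_continuous : continuous clamp01.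
Proof.
move=> t; apply: (@continuous_max R R^o (cst 0) (fun t => Num.min 1 t)).
  exact: cvg_cst.
by apply: (@continuous_min R R^o (cst 1) id); [exact: cvg_cst|exact: cvg_id].
Qed.

Definition segment_pt n (i j : 'I_n) (t : R) : 'rV[R]_n :=
  \row_k ((1 - t) * (k == i)%:R + t * (k == j)%:R).

Lemma segment_pt_continuous n (i j : 'I_n) : continuous (segment_pt i j).
Proof.
apply: matrix_continuous => a k t.
rewrite (_ : (fun t => segment_pt i j t a k) =
  fun t => (1 - t) * (k == i)%:R + t * (k == j)%:R); last first.
  by apply/funext => u; rewrite mxE.
apply: cvgD; apply: cvgM; try exact: cvg_cst; last exact: cvg_id.
by apply: cvgB; [exact: cvg_cst|exact: cvg_id].
Qed.

(** One arc per edge of the complex, listed once by ordering its two vertices. A vertex on no edge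
    would be a clopen point of the connected [G], hence all of [G], although there is an edge. *)
Lemma graph_arc_system : exists (I : finType) (e : I -> R -> G),
  arc_system e [set: G].
Proof.
have [Gc Gconn [n [K [[K0 Ksub] [Kdim Kedge] [h [k [_ kc hP kP]]]]]]] := hG.
pose edge (p : 'I_n * 'I_n) := finset.setU (finset.set1 p.1) (finset.set1 p.2).
pose I := {p : 'I_n * 'I_n | (p.1 < p.2)%N && (edge p \in K)}.
pose seg (p : I) t := segment_pt (val p).1 (val p).2 t.
have seg_carrier p t : 0 <= t <= 1 -> carrier K (seg p t).
  move=> tE; have pK : edge (val p) \in K by case: p => p /= /andP[].
  exists (edge (val p)) => //; split.
  - by move=> l; rewrite mxE; apply: addr_ge0; apply: mulr_ge0 => //; lra.
  - rewrite (eq_bigr (fun l => (1 - t) * (l == (val p).1)%:R + t *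
      (l == (val p).2)%:R)); last first.
      by move=> l _; rewrite mxE.
    have E u : \sum_(l < n) (l == u)%:R = 1 :> R.
      by rewrite (bigD1 u)//= eqxx big1 ?addr0// => v /negbTE ->.
    by rewrite big_split /= -!mulr_sumr !E; ring.
  move=> l; rewrite !inE negb_or => /andP[/negbTE li /negbTE lj].
  by rewrite mxE li lj !mulr0 addr0.
pose e (p : I) t := k (seg p (clamp01 t)).
have eE p t : 0 <= t <= 1 -> e p t = k (seg p t) by move=> tE;
  rewrite /e clamp01_id.
have segK p t : 0 <= t <= 1 -> h (k (seg p t)) = seg p t.
  by move=> tE; have [_ ->] := kP _ (seg_carrier p t tE).
have ltp (p : I) : ((val p).1 < (val p).2)%N by case: p => p /= /andP[].
have neqp (p : I) : ((val p).1 == (val p).2) = false.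
  by apply/eqP => E; have := ltp p; rewrite E ltnn.
have seg1 p t : seg p t ord0 (val p).1 = 1 - t.
  by rewrite mxE eqxx neqp mulr1 mulr0 addr0.
have seg2 p t : seg p t ord0 (val p).2 = t.
  by rewrite mxE eqxx eq_sym neqp mulr1 mulr0 add0r.
have ec p : continuous (e p).
  apply: (within_continuous_curve kc).
    move=> t; apply: (@continuous_comp _ _ _ clamp01 (seg p)).
      exact: clamp01_continuous.
    exact: segment_pt_continuous.
  by move=> t; apply/seg_carrier/clamp01_range.
have einj p s t : 0 <= s <= 1 -> 0 <= t <= 1 -> e p s = e p t -> s = t.
  move=> sE tE; rewrite !eE// => /(congr1 h); rewrite !segK// => E.
  by rewrite -(seg2 p s) -(seg2 p t) E.
have einner p q s t : 0 < s < 1 -> 0 <= t <= 1 -> e p s = e q t -> p = q.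
  move=> sE tE; have sE' : 0 <= s <= 1 by lra.
  rewrite !eE// => /(congr1 h); rewrite !segK// => E.
  have sup l : seg q t ord0 l != 0 -> l = (val q).1 \/ l = (val q).2.
    rewrite mxE; have [->|/negbTE l1] := eqVneq l (val q).1; first by left.
    have [->|/negbTE l2] := eqVneq l (val q).2; first by right.
    by rewrite !mulr0 addr0 eqxx.
  have n1 : seg q t ord0 (val p).1 != 0 by rewrite -E seg1 gt_eqF; lra.
  have n2 : seg q t ord0 (val p).2 != 0 by rewrite -E seg2 gt_eqF; lra.
  have [lp lq] := (ltp p, ltp q).
  apply/val_inj; rewrite [LHS]surjective_pairing [RHS]surjective_pairing.
  by case: (sup _ n1) (sup _ n2) => [E1|E1] [E2|E2]; rewrite E1 E2 // in lp *;
    move: lp lq; rewrite ?ltnn // => /ltn_trans H /H; rewrite ltnn.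
exists I, e; split => // x; split => // _.
pose Z := \bigcup_(p in [set: I]) carc (e p) 0 1.
have Zc : closed Z.
  apply: closed_bigcup => [|p _]; first exact: finite_finset.
  by apply: compact_closed; [exact: metric_hausdorff|exact: carc_compact].
suff : Z x by case=> p _ [t [tE tx]]; exists p, t.
apply: contrapT => nZ.
have edge_pt (i j : 'I_n) t : (i < j)%N -> edge (i, j) \in K -> 0 <= t <= 1 ->
    Z (k (segment_pt i j t)).
  move=> ij ijK tE; have pP : ((i, j).1 < (i, j).2)%N && (edge (i, j) \in K) by
    rewrite /= ij.
  by exists (Sub (i, j) pP) => //; exists t; split => //;
    rewrite eE// /seg SubK.
have [s0 [s0K s02]] := Kedge.
have two_pts (s : {set 'I_n}) : s \in K -> #|s| = 2%N -> exists i j : 'I_n,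
    [/\ (i < j)%N, edge (i, j) = s & edge (i, j) \in K].
  move=> sK /eqP/cards2P[i [j [nij sE]]].
  have [ij|ji|E] := ltngtP i j; last by move: nij; rewrite (val_inj E) eqxx.
    by exists i, j; rewrite /edge /= -sE.
  exists j, i; have -> : edge (j, i) = s by rewrite sE /edge finset.setUC.
  by split.
pose vert (i : 'I_n) : 'rV[R]_n := \row_l (l == i)%:R.
have outside y : ~ Z y -> exists i, y = k (vert i).
  move=> nZy; have [[s sK [y0 y1 ys]] ky] := hP y Logic.I.
  have s0' : (0 < #|s|)%N by rewrite card_gt0; apply: contraNneq K0 => <-.
  have := Kdim s sK; rewrite leq_eqVlt => /orP[/eqP s2|s1]; last first.
    have /eqP/cards1P[i sE] : #|s| = 1%N by apply/eqP;
      rewrite eqn_leq s0' andbT.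
    have yi l : l != i -> h y ord0 l = 0 by move=> li; apply: ys;
      rewrite sE inE.
    exists i; rewrite -[LHS]ky; congr k; apply/rowP => l; rewrite mxE.
    have [->|/yi->//] := eqVneq l i.
    by rewrite -y1 (bigD1 i)//= big1 ?addr0// => u /yi.
  exfalso; apply: nZy; have [i [j [ij eE' eK]]] := two_pts s sK s2.
  have nij : j != i by apply/eqP => E; move: ij; rewrite E ltnn.
  have yl l : l != i -> l != j -> h y ord0 l = 0.
    by move=> li lj; apply: ys; rewrite -eE' !inE negb_or li.
  have yi : h y ord0 i = 1 - h y ord0 j.
    rewrite -y1 (bigD1 i)//= (bigD1 j)//= big1 ?addr0; first by ring.
    by move=> u /andP[ui uj]; exact: yl.
  have [yi0 yj0] := (y0 i, y0 j); rewrite yi in yi0.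
  suff E : y = k (segment_pt i j (h y ord0 j)) by rewrite E;
    apply: edge_pt => //; lra.
  rewrite -[LHS]ky; congr k; apply/rowP => l; rewrite mxE.
  have [->|li] := eqVneq l i; first by rewrite yi eq_sym (negbTE nij) mulr1
    mulr0 addr0.
  have [->|lj] := eqVneq l j; first by rewrite mulr0 mulr1 add0r.
  by rewrite !mulr0 addr0 yl.
have closed_fin (C : set G) : finite_set C -> closed C.
  by apply: finite_closed; exact: metric_hausdorff.
pose P := [set y | exists i, k (vert i) = y /\ y <> x].
have Pc : closed P.
  apply: closed_fin; apply: (@sub_finite_set _ _ ((k \o vert) @` [set: 'I_n])).
    by move=> y [i [<- _]]; exists i.
  by apply: finite_image; exact: finite_finset.
have E : [set x] = [set: G].
  apply: Gconn; first by exists x.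
  - exists (~` Z `&` ~` P); first by apply: openI; exact: closed_openC.
    apply/seteqP; split => [y ->|y [_ [nZy nPy]]].
      by split => //; split => // -[i [_]]; exact.
    have [i yE] := outside y nZy.
    by apply: contrapT => yx; apply: nPy; exists i.
  - by exists [set x]; [apply: closed_fin; exact: finite_set1|rewrite setTI].
have [i [j [ij _ ijK]]] := two_pts s0 s0K s02.
apply: nZ; have : [set x] (k (segment_pt i j 0)) by rewrite E.
by move=> <-; apply: edge_pt => //; lra.
Qed.

End GraphArcs.

(** * Periodic inaccessible ends *)

Lemma compact_disjoint_dist (R : realType) (T : metricType R) (A B : set T) :
  compact A -> closed B -> A `&` B = set0 ->
  \forall eps \near (0 : R)^'+, forall x y, A x -> B y -> eps < mdist x y.
Proof.
move=> Ac Bc AB; have /compact_near_coveringP cov := Ac.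
have near_pt x : A x -> \forall x' \near x & eps \near (0 : R)^'+,
    forall y, B y -> eps < mdist x' y.
  move=> Ax; have nBx : (~` B) x by move=> Bx; have : (A `&` B) x by [];
    rewrite AB.
  have : nbhs x (~` B) by apply: open_nbhs_nbhs; split => //;
    exact: closed_openC.
  move=> /nbhs_ballP[r /= r0 rB].
  exists (ball x (r / 2), [set eps | 0 < eps < r / 2]) => /=.
    split; first by apply: nbhsx_ballx; lra.
    by apply/at_right0P; exists (r / 2) => //; lra.
  move=> [x' eps] [/= xx' epsE] y By; rewrite ltNge; apply/negP => le.
  apply: (rB y) => //; rewrite ballEmdist /=; rewrite ballEmdist /= in xx'.
  by apply: le_lt_trans (metric_triangle x x' y) _; lra.
have H := cov R _ (fun eps x => forall y, B y -> eps < mdist x y) _ near_pt.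
near=> eps => x y Ax; suff : A `<=` (fun x => forall y, B y ->
  eps < mdist x y) by exact.
by near: eps; exact: H.
Unshelve. all: by end_near.
Qed.

Section PeriodicGerm.
Variables (R : realType) (G : metricType R) (L : finType) (g : L -> R -> G).
Hypothesis S : arc_system g [set: G].
Variables (f : G -> G) (f_cont : continuous f) (f_mix : mixing f).
Variables (w : L) (m : nat).
Hypothesis m_gt0 : (0 < m)%N.
Hypothesis m_inv : forall d : R, 0 < d -> \forall t \near 0^'+,
  exists s, 0 < s < d /\ iter m f (g w t) = g w s.
Hypothesis m_pre : forall eps : R, 0 < eps -> \forall s \near 0^'+, forall x,
  iter m f x = g w s -> exists t, 0 < t < eps /\ x = g w t.

Let m_mix (U V : set G) : open U -> open V -> U !=set0 -> V !=set0 ->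
  exists k, (iter k (iter m f) @` U) `&` V !=set0.
Proof.
move=> Uo Vo U0 V0; have [N [_ H]] := f_mix Uo Vo U0 V0; exists N.
have [_ [[x Ux <-] Vx]] := H (N * m)%N (leq_pmulr N m_gt0).
by exists (iter (N * m) f x); split => //; exists x => //; rewrite iterM.
Qed.

Let germ := return_map_germ (@metric_hausdorff _ G) S
  (@continuous_iter _ f m f_cont) m_mix m_inv m_pre.

Lemma periodic_germ_fixed_points : infinite_set [set x : G | iter m f x = x].
Proof.
have [s [d [D [[s0 sd dD D1] rP rc rup rdown]]]] := germ.
pose r := return_map g (iter m f) w.
have r0 t : 0 < t < D -> 0 < r t by move=> /rP[/andP[]].
have fixp (eta : R) : 0 < eta -> exists p, 0 < p < eta /\ r p = p.
  exact: (germ_fixed_points s0 sd dD rc r0 rup rdown).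
move=> fin; pose P := [set p | 0 < p < D /\ r p = p].
have gfix p : P p -> iter m f (g w p) = g w p.
  by move=> [pE rp]; have [_ ->] := rP p pE; rewrite -/(r p) rp.
have finP : finite_set P.
  have ginj : {in P &, injective (g w)}.
    move=> p q; rewrite !inE => -[pE _] [qE _] E.
    by apply: (arc_inj S _ _ E); lra.
  have : finite_set (g w @` P).
    by apply: sub_finite_set fin => _ [p Pp <-]; exact: gfix.
  by rewrite (eq_finite_set (inj_card_eq ginj)).
(* A finite set of positive fixed points stays away from 0, where [fixp] still finds one. *)
have clP : closed P.
  by apply: finite_closed => //; exact: Rhausdorff.
have nP0 : (~` P) 0 by move=> [/andP[]]; rewrite ltxx.
have : nbhs (0 : R) (~` P) by apply: open_nbhs_nbhs; split => //;
  exact: closed_openC.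
move=> /nbhs_ballP[eps /= eps0 epsP].
have m0 : 0 < Num.min eps D by rewrite lt_min eps0; lra.
have [me mD] : Num.min eps D <= eps /\ Num.min eps D <= D by rewrite !ge_min
  !lexx orbT.
have [p [pE rp]] := fixp _ m0.
apply: (epsP p); last by split => //; lra.
by rewrite /ball /= sub0r normrN gtr0_norm; lra.
Qed.

Lemma periodic_germ_entropy : ((m%:R^-1 * ln 3)%:E <= topological_entropy f)%E.
Proof.
have [s [d [D [[s0 sd dD D1] rP rc rup rdown]]]] := germ.
pose r := return_map g (iter m f) w.
have r0 t : 0 < t < D -> 0 < r t by move=> /rP[/andP[]].
have [b [a [l [u [bE ad luE disj cover]]]]] :=
  germ_horseshoe s0 sd dD rc r0 rup rdown.
pose K (c : 'I_3) := carc (g w) (l c) (u c).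
have K01 c t : l c <= t <= u c -> 0 < t < D /\ b <= t <= a.
  by have [? ? ?] := luE c; move=> tE; split; lra.
have KI (c c' : 'I_3) : c != c' -> K c `&` K c' = set0.
  wlog cc' : c c' / (c < c')%N => [H|_].
    have [lt|lt|/val_inj ->] := ltngtP c c'; [exact: H| |by rewrite eqxx].
    by rewrite eq_sym setIC; exact: H.
  apply/seteqP; split => // x [[t [tE tx]] [t' [tE' tx']]].
  have [tD _] := K01 c t tE; have [tD' _] := K01 c' t' tE'.
  have E : t = t' by apply: (arc_inj S (i := w)); [lra|lra|rewrite tx tx'].
  have := disj c c' cc'; rewrite E in tE; move=> lt.
  by have : t' < t' by [lra]; rewrite ltxx.
have Kc c : compact (K c) by apply: carc_compact; exact: arc_cont.
have : \forall eps \near (0 : R)^'+, forall c c' : 'I_3, c != c' ->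
    forall x y, K c x -> K c' y -> eps < mdist x y.
  apply: filter_forall => c; apply: filter_forall => c'.
  have [->|cc'] := eqVneq c c'; first by apply/at_right0P; exists 1 => //.
  have := compact_disjoint_dist (Kc c)
    (compact_closed (@metric_hausdorff _ G) (Kc c')) (KI _ _ cc').
  by apply: filterS => eps + _.
move=> sep; have pos : \forall eps \near (0 : R)^'+, 0 < eps by exact:
  nbhs_right_gt.
near (0 : R)^'+ => eps; have eps0 : 0 < eps by near: eps.
have sepH : forall c c' : 'I_3, c != c' ->
    forall x y, K c x -> K c' y -> eps < mdist x y by near: eps.
apply: (@horseshoe_entropy _ _ f 3 m eps K ord0) => //.
- by have [? ? ?] := luE ord0; exists (g w (l ord0)), (l ord0); split => //;
    lra.
- move=> c c' x [t [tE <-]]; have [_ tE'] := K01 c' t tE.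
  have [v vE vt] := cover c t tE'; have [vD _] := K01 c v vE.
  exists (g w v); first by exists v.
  by have [_ ->] := rP v vD; rewrite vt.
- by move=> c c' x y cc' Kx Ky; exact: (sepH c c').
Unshelve. all: by end_near. Qed.

End PeriodicGerm.

Lemma inaccessible_lt_Lambda (R : realType) (G : metricType R) (f : G -> G)
    (L : finType) (g : L -> R -> G) (F : nat -> set G) : is_graph [set: G] ->
  leg_exhaustion f g F ->
  (#|[pred l : L | `[< inaccessible g F l >]]| < Lambda G)%N.
Proof.
move=> hG gF; have [Gc _ _] := hG; have Gh := @metric_hausdorff R G.
have [I [e eS]] := graph_arc_system hG.
have [n _ /(_ n (leqnn n)) fr] := frontier_exists Gh gF.
pose a l := projT1 (cid (fr l)).
have aP l : frontier g F n l (a l) by rewrite /a; case: cid.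
have [l0 l0i] := inaccessible_exists gF.
apply: (Lambda_gt eS (H := F n)).
  apply: (arc_system_is_graph (frontier_arc_system Gh gF aP)).
  - by apply: (subclosed_compact _ Gc) => //; exact: (leg_closed gF).
  - exact: (leg_connected gF).
  - have [_ _ _ _ Fl] := aP l0; have [al _ _ _ _] := aP l0.
    by exists (g l0 1); apply: Fl; lra.
move=> k /andP[k0 kw].
(* Only [k] of the cut points are removed, so that every size up to the number of inaccessible ends
   is realized. *)
pose ls := take k (enum [pred l : L | `[< inaccessible g F l >]]).
have szls : size ls = k by rewrite size_takel// -cardE.
have lsi l : l \in ls -> inaccessible g F l.
  by move=> /mem_take; rewrite mem_enum => /asboolP.
have uls : uniq ls by rewrite take_uniq// enum_uniq.
exists [set g l (a l) | l in [set` ls]]; split.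
- move=> _ [l /= lls <-]; have [al _ _ _ Fl] := aP l; apply: Fl.
  by rewrite lexx /=; lra.
- rewrite (_ : [set g l (a l) | l in [set` ls]] =
    (fun j => g (nth l0 ls j) (a (nth l0 ls j))) @` `I_k).
    apply: inj_card_eq => i j; rewrite !inE /= => ik jk E.
    have il : inaccessible g F (nth l0 ls i) by apply/lsi/mem_nth; rewrite szls.
    have [aj _ _ _ _] := aP (nth l0 ls j).
    have [|Eij _] := frontier_inner gF aP il _ E; first by lra.
    by apply/eqP; rewrite -(nth_uniq l0 _ _ uls) ?szls// Eij.
  apply/seteqP; split => [_ [l /= lls <-]|_ [j /= jk <-]].
    by exists (index l ls); [rewrite /= -szls index_mem|rewrite nth_index].
  by exists (nth l0 ls j) => //=; apply/mem_nth; rewrite szls.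
- exact: (frontier_removal Gh gF aP uls lsi).
Qed.

Theorem theorem7p3 (R : realType) (G : metricType R) (f : G -> G)
    (hG : is_graph [set: G]) (hf : continuous f) (hpm : pure_mixing f) :
  (((Lambda G)%:R^-1 * ln 3)%:E < topological_entropy f)%E /\
  exists m : nat, (0 < m < Lambda G)%N /\
    infinite_set [set x : G | iter m f x = x].
Proof.
have [f_mix /existsNP[U /not_implyP[Uo /not_implyP[U0 /forallNP Unf]]]] := hpm.
have [Gc _ _] := hG; have Gh := @metric_hausdorff R G.
have [I [e eS]] := graph_arc_system hG.
have [i [a [b [a0 ab b1 abU]]]] := open_sub_arc eS Uo U0.
have [a' [b' [aa' ab' bb' rec]]] := recurrent_arc Gh eS hf f_mix i a0 ab b1.
pose J := carc (e i) a' b'.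
have JU : J `<=` U by move=> _ [t [tE <-]]; apply: abU; exists t; split => //;
  lra.
have J_arc : exists i (a b : R), [/\ 0 < a, a < b, b < 1 & J = carc (e i) a b].
  by exists i, a', b'; split => //; lra.
have J_full n : iter n f @` J <> [set: G].
  move=> JT; apply: (Unf n); rewrite -subTset -JT => _ [x Jx <-].
  by exists x => //; exact: JU.
have [L [g gF]] := leg_exhaustion_exists Gh eS hf f_mix J_arc J_full rec.
have [w [m [_ /andP[m0 mW] m_inv m_pre]]] := periodic_germ Gh Gc hf f_mix gF.
have mL : (m < Lambda G)%N := leq_ltn_trans mW (inaccessible_lt_Lambda hG gF).
have S := leg_arcs gF; split; last first.
  exists m; rewrite m0 mL; split => //.
  exact: (periodic_germ_fixed_points S hf f_mix m0 m_inv m_pre).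
(* The horseshoe gives only a weak inequality with [m]; strictness comes from [m < Lambda G]. *)
apply: lt_le_trans (periodic_germ_entropy S hf f_mix m0 m_inv m_pre).
rewrite lte_fin ltr_pM2r ?ln_gt0 ?ltr1n//.
by rewrite ltf_pV2 ?posrE ?ltr0n ?ltr_nat// (leq_trans _ mL).
Qed.
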